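(* Fix $\Delta=(\Delta t,\Delta x)$. Then: (i) The scheme $(P^\Delta)$, and the scheme $(P^\Delta_\varepsilon)$ for every $\varepsilon\in(0,1]$, are free-energy dissipating numerical schemes over $\mathcal A_{\Delta,+}$. If $\rho^0\in\mathcal A_{\Delta,+}$, then $J^\Delta_\varepsilon\rho^0\to J^\Delta\rho^0$ as $\varepsilon\to0$. (ii) If in addition $U\in C^1([0,\alpha])$, then $(P^\Delta)$ is a free-energy dissipating numerical scheme over $\mathcal A_\Delta$.
   Context: Setting. $\Omega=(0,1)$. Standing assumptions: (1) $\alpha\in(0,\infty)$, $\mathrm m\in C([0,\alpha])\cap C^1((0,\alpha))$, $\mathrm m(0)=\mathrm m(\alpha)=0$, $\mathrm m>0$ on $(0,\alpha)$; (2) $V\in C^2([0,1])$, $V\ge0$; (3) $U\in W^{1,1}((0,\alpha))\cap C^3((0,\alpha))$, $U''\ge0$, and $s_0\in(0,\alpha)$ is a fixed point with $U''(s_0)>0$; (4) $\mathrm m U''\in L^1(0,\alpha)$ and, with $\Phi(s):=\int_{s_0}^s\mathrm m(\tau)U''(\tau)\,d\tau$, one has $\Phi(0)<\Phi(s)<\Phi(\alpha)$ for $s\in(0,\alpha)$ and $$\sup_{s\in[0,\alpha]}\left|\tfrac{(\Phi(\alpha)-\Phi(s))\Phi(s)}{\Phi'(s)}\right|+\left|\tfrac{(\Phi(s)-\Phi(0))\Phi(s)}{\Phi'(s)}\right|<\infty .$$ Regularisation, $\varepsilon\in(0,1]$. $\kappa(\varepsilon)>0$ with $\kappa(\varepsilon)\to0$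 as $\varepsilon\to0$. $\Phi_\varepsilon\in C^3([0,\alpha])$ satisfies $g_\varepsilon\le\Phi_\varepsilon'\le(1+\varepsilon)g_\varepsilon$, where $g_\varepsilon(s)=\min(\Phi'(s),\kappa(\varepsilon)^{-1})+\varepsilon$, $\Phi_\varepsilon(s_0)=0$, and $\Phi_\varepsilon\to\Phi$ in $C^2_{loc}((0,\alpha))$. $\mathrm m_\varepsilon\in C^1([0,\alpha])$ satisfies $\mathrm m_\varepsilon(0)=\mathrm m_\varepsilon(\alpha)=0$, $\mathrm m_\varepsilon>0$ in $(0,\alpha)$, $|\mathrm m_\varepsilon'|>1$ near $0$ and $\alpha$. $U_\varepsilon\in C^{3,1}((0,\alpha))$ is given by $U_\varepsilon''=\Phi_\varepsilon'/\mathrm m_\varepsilon$, $U_\varepsilon(\alpha/2)=U(\alpha/2)$, $U_\varepsilon'(\alpha/2)=U'(\alpha/2)$. Moreover $\mathrm m_\varepsilon\to\mathrm m$ pointwise as $\varepsilon\to0$, $\sup_{\varepsilon\in(0,1)}\|U_\varepsilon'\|_{L^1((0,\alpha))}<\infty$, and $(\varepsilon,s)\mapsto\mathrm m_\varepsilon(s)$ (with $\mathrm m_0=\mathrm m$) belongs to $C([0,1]\times[0,\alpha])\cap C^\infty_{loc}((0,1]\times[0,\alpha])$. Decomposition of mobilities. $\mathrm m=\mathrm m^{(1)}\mathrm m^{(2)}$ with $\mathrm m^{(j)}:[0,\alpha]\to[0,\infty)$ Lipschitz continuous, $\mathrm m^{(1)}$ non-decreasing, $\mathrm m^{(2)}$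 non-increasing. Likewise, for each $\varepsilon\in(0,1]$, $\mathrm m_\varepsilon=\mathrm m_\varepsilon^{(1)}\mathrm m_\varepsilon^{(2)}$ with factors having the same properties. Scheme $(P^\Delta)$. Let $N\in\mathbb N$, $I=\{1,\dots,N\}$, $\Delta x=1/N$, $\Delta t>0$, $x_{i+1/2}=i\Delta x$, $x_i=(i-\frac12)\Delta x$. Given $\rho^n\in\mathbb R^{|I|}$ (with entries in $[0,\alpha]$), $\rho^{n+1}$ solves, for $i\in I$, $$\frac{\rho_i^{n+1}-\rho_i^n}{\Delta t}=-\frac{F_{i+\frac12}(\rho^{n+1})-F_{i-\frac12}(\rho^{n+1})}{\Delta x},$$ $$F_{i+\frac12}(\rho)=\mathrm m^{(1)}(\rho_i)\mathrm m^{(2)}(\rho_{i+1})(v_{i+\frac12}(\rho))^++\mathrm m^{(1)}(\rho_{i+1})\mathrm m^{(2)}(\rho_i)(v_{i+\frac12}(\rho))^-,$$ $$v_{i+\frac12}(\rho)=-\frac{\xi_{i+1}(\rho)-\xi_i(\rho)}{\Delta x},\quad \xi_i(\rho)=U'(\rho_i)+V(x_i),\quad F_{\frac12}=F_{N+\frac12}=0,$$ with the convention $u=u^++u^-$ (so $u^+=\max(u,0)$, $u^-=\min(u,0)$). Scheme $(P^\Delta_\varepsilon)$ is the same with $\mathrm m^{(j)},U$ replaced by $\mathrm m_\varepsilon^{(j)},U_\varepsilon$. $\mathcal A_\Delta=\{\rho\in\mathbb R^{|I|}:0\le\rho_i\le\alpha\}$, $\mathcal A_{\Delta,+}=\{\rho\in\mathbb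 R^{|I|}:0<\rho_i<\alpha\}$, $\|\rho\|_{L^1_\Delta}=\sum_{i\in I}|\rho_i|$. Discrete energies: $E^\Delta[\rho]=\Delta x\sum_{i\in I}(U(\rho_i)+V(x_i)\rho_i)$ and $E_\varepsilon^\Delta$ the same with $U_\varepsilon$. One-step solution maps: $J^\Delta:\rho^0\mapsto\rho^1$ for $(P^\Delta)$, $J_\varepsilon^\Delta:\rho^0\mapsto\rho^1$ for $(P_\varepsilon^\Delta)$. Definition. $(P^\Delta)$ is a free-energy dissipating numerical scheme over $\mathcal B\subset\mathcal A_\Delta$ if: (a) for every $\rho^0\in\mathcal B$ there is a unique $\rho\in\mathcal B$ solving one step of the scheme starting from $\rho^0$ (denoted $\rho^1=J^\Delta\rho^0$); (b) the solution map $J^\Delta$ is an $L^1_\Delta$-contraction, $\|J^\Delta\rho^0-J^\Delta\eta^0\|_{L^1_\Delta}\le\|\rho^0-\eta^0\|_{L^1_\Delta}$ for $\rho^0,\eta^0\in\mathcal B$, and mass is conserved, $\sum_i(J^\Delta\rho^0)_i=\sum_i\rho^0_i$; (c) $E^\Delta[J^\Delta\rho^0]\le E^\Delta[\rho^0]$ for $\rho^0\in\mathcal B$. The same definition applies to $(P^\Delta_\varepsilon)$ with $J^\Delta_\varepsilon$, $E^\Delta_\varepsilon$.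
   Formalization: The convergence of the regularised solution maps as ε→0 is stated under the added assumption that the mobility factors m_ε^(1), m_ε^(2) converge pointwise on [0,α] to m^(1), m^(2); without a link between the factors the claim is false. *)

(* Defs.v *)
From HB Require Import structures.
From mathcomp Require Import all_boot all_order all_algebra.
From mathcomp Require Import all_classical all_reals all_analysis.

Set Implicit Arguments.
Unset Strict Implicit.
Unset Printing Implicit Defensive.

Import Order.TTheory GRing.Theory Num.Theory.
Import numFieldNormedType.Exports.

Local Open Scope ring_scope.
Local Open Scope classical_set_scope.

(** * Function spaces *)

(** Derivative relative to a set; one-sided at the end points of an interval. *)

Definition quot_on (R : realType) (A : set R) (f : R -> R) (x : R) :
    set_system R :=
  (f y - f x) / (y - x) @[y --> within A x^'].

Definition derive_on (R : realType) (A : set R) (f : R -> R) (x : R) : R :=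
  lim (quot_on A f x).

Definition derivable_on (R : realType) (A : set R) (f : R -> R) (x : R) : Prop :=
  cvg (quot_on A f x).

Lemma derive_onE (R : realType) (A : set R) (f : R -> R) (x : R) :
  nbhs x A -> derive_on A f x = f^`() x.
Proof.
move=> nA; rewrite /derive_on /quot_on /derive1.
have -> : within A x^' = x^'.
  apply/seteqP; split => P; last by apply: cvg_within.
  move=> H; rewrite /dnbhs /within/=.
  have H' : \forall y \near x, y != x -> A y -> P y by exact: H.
  by near=> y => yx; apply: (near H' y) => //; near: y.
congr lim.
apply/seteqP; split => P /= H.
- have [e e0 He] := H.
  exists e => // h /= he h0.
  have := He (h + x); rewrite /ball/= addrK.
  have -> : `|x - (h + x)| < e by move: he; rewrite /= opprD addrCA subrr addr0 sub0r.
  rewrite mulrC; apply => //.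
  by rewrite -subr_eq0 addrK.
- have [e e0 He] := H.
  exists e => // y /= ye yx.
  have := He (y - x); rewrite /ball/= sub0r subrK opprB mulrC; apply => //.
  by rewrite subr_eq0.
Unshelve. all: by end_near. Qed.

Definition derivn_on (R : realType) (A : set R) (k : nat) (f : R -> R) : R -> R :=
  iter k (derive_on A) f.

(** [C^n([a, b])] *)
Definition Cn_cc (R : realType) (n : nat) (a b : R) (f : R -> R) : Prop :=
  (forall (k : nat) (x : R), (k < n)%N -> a <= x <= b ->
     derivable_on `[a, b] (derivn_on `[a, b] k f) x) /\
  {within `[a, b], continuous (derivn_on `[a, b] n f)}.

(** [C^n((a, b))] *)
Definition Cn_oo (R : realType) (n : nat) (a b : R) (f : R -> R) : Prop :=
  forall x : R, a < x < b ->
    (forall k, (k < n)%N -> derivable (derive1n k f) x 1) /\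
    {for x, continuous (derive1n n f)}.

(** [C^{n,1}((a, b))]; the Lipschitz condition on the [n]-th derivative is
    local, that is, imposed on compact subintervals. *)
Definition Cn1_oo (R : realType) (n : nat) (a b : R) (f : R -> R) : Prop :=
  Cn_oo n a b f /\
  forall c d : R, a < c -> d < b -> [lipschitz derive1n n f x | x in `[c, d]].

(** [C^n(I x J)] for intervals [I] and [J]: all iterated partial derivatives of
    order at most [n], taken relative to [I] and [J], exist and are jointly
    continuous. *)
Fixpoint Cn_prod (R : realType) (I J : set R) (n : nat) (f : R -> R -> R) :
    Prop :=
  {within I `*` J, continuous (fun p : R * R => f p.1 p.2)} /\
  if n is k.+1 then
    [/\ forall x y : R, I x -> J y ->
          derivable_on I (f ^~ y) x /\ derivable_on J (f x) y,
        Cn_prod I J k (fun x y => derive_on I (f ^~ y) x) &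
        Cn_prod I J k (fun x y => derive_on J (f x) y)]
  else True.

Definition Cinf_prod (R : realType) (I J : set R) (f : R -> R -> R) : Prop :=
  forall n, Cn_prod I J n f.

(** [L^1((a, b))] *)
Definition L1_oo (R : realType) (a b : R) (f : R -> R) : Prop :=
  (@lebesgue_measure R).-integrable `]a, b[ (EFin \o f).

(** [C_c^oo((a, b))], extended by [0] outside of [(a, b)] *)
Definition test_function (R : realType) (a b : R) (phi : R -> R) : Prop :=
  (forall (n : nat) (x : R), derivable (derive1n n phi) x 1) /\
  exists c d : R, [/\ a < c, d < b & forall x : R, ~~ (c <= x <= d) -> phi x = 0].

(** [W^{1,1}((a, b))] *)
Definition W11_oo (R : realType) (a b : R) (f : R -> R) : Prop :=
  L1_oo a b f /\
  exists2 g, L1_oo a b g &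
    forall phi, test_function a b phi ->
      \int[@lebesgue_measure R]_(x in `]a, b[) (f x * derive1 phi x) =
      - \int[@lebesgue_measure R]_(x in `]a, b[) (g x * phi x).

(** * Standing assumptions *)

(** The oriented integral of [m U''] from [s0] to [s] *)
Definition Phi_of (R : realType) (m U : R -> R) (s0 s : R) : R :=
  if s0 <= s
  then \int[@lebesgue_measure R]_(t in `[s0, s]) (m t * derive1n 2 U t)
  else - \int[@lebesgue_measure R]_(t in `[s, s0]) (m t * derive1n 2 U t).

Record mobility_asm (R : realType) (alpha : R) (m : R -> R) : Prop := {
  alpha_gt0 : 0 < alpha;
  mob_cont : Cn_cc 0 0 alpha m;
  mob_C1 : Cn_oo 1 0 alpha m;
  mob_0 : m 0 = 0;
  mob_alpha : m alpha = 0;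
  mob_gt0 : forall s : R, 0 < s < alpha -> 0 < m s }.

Record potential_asm (R : realType) (V : R -> R) : Prop := {
  pot_C2 : Cn_cc 2 0 1 V;
  pot_ge0 : forall x : R, 0 <= x <= 1 -> 0 <= V x }.

Record entropy_asm (R : realType) (alpha s0 : R) (U : R -> R) : Prop := {
  ent_W11 : W11_oo 0 alpha U;
  ent_C3 : Cn_oo 3 0 alpha U;
  ent_convex : forall s : R, 0 < s < alpha -> 0 <= derive1n 2 U s;
  ent_s0 : 0 < s0 < alpha;
  ent_s0_gt0 : 0 < derive1n 2 U s0 }.

(** In the last condition the quotients are extended-real: [r / 0] is infinite
    for [r != 0], so that [Phi'] has no zero in [(0, alpha)].  [Phi'] is
    available on the open interval only, and so is the supremum. *)
Record Phi_asm (R : realType) (alpha s0 : R) (m U : R -> R) : Prop := {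
  Phi_L1 : L1_oo 0 alpha (fun s => m s * derive1n 2 U s);
  Phi_bounds : forall s : R, 0 < s < alpha ->
    Phi_of m U s0 0 < Phi_of m U s0 s < Phi_of m U s0 alpha;
  Phi_sup : let Phi := Phi_of m U s0 in
    let quot (r s : R) := `|r%:E / (derive1 Phi s)%:E|%E in
    (ereal_sup [set quot ((Phi alpha - Phi s) * Phi s)%R s
                      + quot ((Phi s - Phi 0) * Phi s)%R s
               | s in `]0%R, alpha[] < +oo)%E }.

Record standing_asm (R : realType) (alpha s0 : R) (m V U : R -> R) : Prop := {
  std_mobility : mobility_asm alpha m;
  std_potential : potential_asm V;
  std_entropy : entropy_asm alpha s0 U;
  std_Phi : Phi_asm alpha s0 m U }.

(** * Regularisation *)

(** In [Phie e], [me e], [Ue e] the first argument is the parameter epsilon; the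
    families are constrained for [e] in [(0, 1]] only, except that [me 0 = m]. *)

Definition g_reg (R : realType) (alpha s0 : R) (m U kappa : R -> R) (e s : R) : R :=
  Num.min (derive1 (Phi_of m U s0) s) (kappa e)^-1 + e.

Record Phi_reg (R : realType) (alpha s0 : R) (m U kappa : R -> R)
    (Phie : R -> R -> R) : Prop := {
  kappa_gt0 : forall e : R, 0 < e <= 1 -> 0 < kappa e;
  kappa_cvg : kappa e @[e --> 0^'+] --> 0;
  Phie_C3 : forall e : R, 0 < e <= 1 -> Cn_cc 3 0 alpha (Phie e);
  Phie_bounds : forall e s : R, 0 < e <= 1 -> 0 < s < alpha ->
    g_reg alpha s0 m U kappa e s <= derive1 (Phie e) s
      <= (1 + e) * g_reg alpha s0 m U kappa e s;
  Phie_s0 : forall e : R, 0 < e <= 1 -> Phie e s0 = 0;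
  Phie_cvg : forall (k : nat) (c d : R), (k <= 2)%N -> 0 < c -> d < alpha ->
    {uniform `[c, d], derive1n k (Phie e) @[e --> 0^'+] -->
                      derive1n k (Phi_of m U s0)} }.

Record mobility_reg (R : realType) (alpha : R) (m : R -> R)
    (me : R -> R -> R) : Prop := {
  me_C1 : forall e : R, 0 < e <= 1 -> Cn_cc 1 0 alpha (me e);
  me_0 : forall e : R, 0 < e <= 1 -> me e 0 = 0;
  me_alpha : forall e : R, 0 < e <= 1 -> me e alpha = 0;
  me_gt0 : forall e s : R, 0 < e <= 1 -> 0 < s < alpha -> 0 < me e s;
  me_slope : forall e : R, 0 < e <= 1 ->
    (\forall s \near within `[0, alpha] (nbhs (0 : R)),
       1 < `|derive_on `[0, alpha] (me e) s|) /\
    (\forall s \near within `[0, alpha] (nbhs alpha),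
       1 < `|derive_on `[0, alpha] (me e) s|);
  me_cvg : forall s : R, 0 <= s <= alpha -> me e s @[e --> 0^'+] --> m s;
  me_zero : forall s : R, 0 <= s <= alpha -> me 0 s = m s;
  me_cont : {within `[0, 1] `*` `[0, alpha],
              continuous (fun p : R * R => me p.1 p.2)};
  me_smooth : Cinf_prod `]0, 1] `[0, alpha] me }.

Record entropy_reg (R : realType) (alpha : R) (U : R -> R)
    (Phie me Ue : R -> R -> R) : Prop := {
  Ue_C31 : forall e : R, 0 < e <= 1 -> Cn1_oo 3 0 alpha (Ue e);
  Ue_second : forall e s : R, 0 < e <= 1 -> 0 < s < alpha ->
    derive1n 2 (Ue e) s = derive1 (Phie e) s / me e s;
  Ue_mid : forall e : R, 0 < e <= 1 -> Ue e (alpha / 2) = U (alpha / 2);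
  dUe_mid : forall e : R, 0 < e <= 1 ->
    derive1 (Ue e) (alpha / 2) = derive1 U (alpha / 2);
  dUe_L1 : (ereal_sup
      [set \int[@lebesgue_measure R]_(s in `]0%R, alpha[)
             `|derive1 (Ue e) s|%:E
      | e in `]0%R, 1%R[] < +oo)%E }.

Record regularisation (R : realType) (alpha s0 : R) (m U kappa : R -> R)
    (Phie me Ue : R -> R -> R) : Prop := {
  reg_Phi : Phi_reg alpha s0 m U kappa Phie;
  reg_mobility : mobility_reg alpha m me;
  reg_entropy : entropy_reg alpha U Phie me Ue }.

(** [m = m1 m2] on [[0, alpha]] *)
Record mobility_split (R : realType) (alpha : R) (m m1 m2 : R -> R) : Prop := {
  split_eq : forall s : R, 0 <= s <= alpha -> m s = m1 s * m2 s;
  split_ge0 : forall s : R, 0 <= s <= alpha -> 0 <= m1 s /\ 0 <= m2 s;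
  split_lip1 : [lipschitz m1 s | s in `[0, alpha]];
  split_lip2 : [lipschitz m2 s | s in `[0, alpha]];
  split_incr : forall s t : R, 0 <= s -> s <= t -> t <= alpha -> m1 s <= m1 t;
  split_decr : forall s t : R, 0 <= s -> s <= t -> t <= alpha -> m2 t <= m2 s }.

(** * The scheme *)

(** Cells are numbered [1, ..., N] and [cell rho i] is the entry of [rho] for the
    cell [i]; its value is relevant for [1 <= i <= N] only. *)
Definition cell (R : realType) (N : nat) (rho : 'rV[R]_N) (i : nat) : R :=
  oapp (rho 0) 0 (insub i.-1).

Definition mesh (R : realType) (N : nat) : R := N%:R^-1.

Definition midpoint (R : realType) (N i : nat) : R := (i%:R - 2^-1) * mesh R N.

(** [U'] is the derivative relative to [[0, alpha]], so that it also makes sense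
    at [0] and [alpha] when [U] is [C^1([0, alpha])]. *)
Definition xi (R : realType) (N : nat) (alpha : R) (U V : R -> R)
    (rho : 'rV[R]_N) (i : nat) : R :=
  derive_on `[0, alpha] U (cell rho i) + V (midpoint R N i).

(** [velocity ... i] and [flux ... i] are the values at the interface
    [x_{i + 1/2}], [0 <= i <= N]. *)
Definition velocity (R : realType) (N : nat) (alpha : R) (U V : R -> R)
    (rho : 'rV[R]_N) (i : nat) : R :=
  - (xi alpha U V rho i.+1 - xi alpha U V rho i) / mesh R N.

Definition flux (R : realType) (N : nat) (alpha : R) (m1 m2 U V : R -> R)
    (rho : 'rV[R]_N) (i : nat) : R :=
  if (0 < i < N)%N then
    m1 (cell rho i) * m2 (cell rho i.+1) * Num.max (velocity alpha U V rho i) 0 +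
    m1 (cell rho i.+1) * m2 (cell rho i) * Num.min (velocity alpha U V rho i) 0
  else 0.

Definition one_step (R : realType) (N : nat) (alpha dt : R) (m1 m2 U V : R -> R)
    (rho0 rho1 : 'rV[R]_N) : Prop :=
  forall i, (1 <= i <= N)%N ->
    (cell rho1 i - cell rho0 i) / dt =
    - (flux alpha m1 m2 U V rho1 i - flux alpha m1 m2 U V rho1 i.-1) / mesh R N.

Definition A_closed (R : realType) (N : nat) (alpha : R) : set 'rV[R]_N :=
  [set rho | forall i, 0 <= rho 0 i <= alpha].

Definition A_open (R : realType) (N : nat) (alpha : R) : set 'rV[R]_N :=
  [set rho | forall i, 0 < rho 0 i < alpha].

Definition L1norm (R : realType) (N : nat) (rho : 'rV[R]_N) : R :=
  \sum_(i < N) `|rho 0 i|.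

Definition energy (R : realType) (N : nat) (U V : R -> R) (rho : 'rV[R]_N) : R :=
  mesh R N * \sum_(i < N) (U (rho 0 i) + V (midpoint R N i.+1) * rho 0 i).

(** A scheme is a relation [step rho0 rho1]; the solution map over [B] picks the
    solution in [B] (and is junk if there is none). *)
Definition solution_map (R : realType) (N : nat) (B : set 'rV[R]_N)
    (step : 'rV[R]_N -> 'rV[R]_N -> Prop) (rho0 : 'rV[R]_N) : 'rV[R]_N :=
  xget 0 [set rho | B rho /\ step rho0 rho].

Record energy_dissipating (R : realType) (N : nat) (B : set 'rV[R]_N)
    (step : 'rV[R]_N -> 'rV[R]_N -> Prop) (E : 'rV[R]_N -> R) : Prop := {
  fed_solvable : forall rho0, B rho0 -> exists! rho, B rho /\ step rho0 rho;
  fed_contraction : forall rho0 eta0, B rho0 -> B eta0 ->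
    L1norm (solution_map B step rho0 - solution_map B step eta0)
      <= L1norm (rho0 - eta0);
  fed_mass : forall rho0, B rho0 ->
    \sum_(i < N) solution_map B step rho0 0 i = \sum_(i < N) rho0 0 i;
  fed_energy : forall rho0, B rho0 ->
    E (solution_map B step rho0) <= E rho0 }.

(* Main.v *)
Require Import Defs.
From mathcomp Require Import all_boot all_order all_algebra.
From mathcomp Require Import all_classical all_reals all_analysis.
From mathcomp Require Import ring lra.
Import Order.TTheory GRing.Theory Num.Theory.
Import numFieldNormedType.Exports.
Local Open Scope ring_scope.
Local Open Scope classical_set_scope.
Set Implicit Arguments.
Unset Strict Implicit.
Unset Printing Implicit Defensive.

(** One step of the scheme asks for [rho] with [T rho = rho0], where
    [T rho i = rho_i + (dt / dx) (F_{i+1/2}(rho) - F_{i-1/2}(rho))].  Everything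
    rests on one structural fact: because [U'] is nondecreasing, [m1] is
    nondecreasing and [m2] is nonincreasing, the upwind flux through an interface
    is nondecreasing in the state on its left and nonincreasing in the state on
    its right ([interface_flux_monotone]).

    Contraction and uniqueness.  Testing [T rho - T eta] against the signs of
    [rho - eta] and summing by parts, monotonicity makes the flux contribution
    nonnegative, so that [T] expands the [L^1] distance
    ([backward_step_L1_expansive]).  Mass conservation is a telescoping sum.

    Existence.  If all neighbours of a cell are kept fixed, [T rho i] is a
    continuous, strictly increasing function of [rho_i], and it is nonincreasing
    in the neighbours.  Solving each cell separately is therefore a monotone map
    on a box [[a, b]^N] as soon as [T] of the constant state [a] lies below
    [rho0] and [T] of the constant state [b] lies above it, and a monotone map of
    a box into itself has a fixed point, by Tarski's supremum argument
    ([monotone_box_fixpoint], [backward_step_solvable]).  No a priori bound on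
    [U'] near [0] and [alpha] enters: on a constant state [c] the contributions
    of [U'] to the velocity cancel, and [T c = c + K (m c)] with [K] determined by
    [V] and the cell ([backward_step_const]).  Since [m] vanishes at [0] and
    [alpha], constants close to these values are barriers for every [rho0] with
    entries in [(0, alpha)]; if [U'] is continuous up to the end points, then
    [0] and [alpha] themselves are barriers.

    Energy.  By convexity the energy drop is at least the pairing of [xi(rho)]
    with [rho0 - rho], which after summation by parts is a sum of products of a
    flux and the velocity at the same interface; upwinding makes these products
    nonnegative ([energy_decreases]).

    Convergence.  Let [rho] be the solution of the limit scheme and [rho_e] that
    of the regularised one.  Expansivity of [T_e] bounds the distance from [rho_e]
    to [rho] by the distance from [T_e rho_e = rho0 = T rho] to [T_e rho], the
    consistency error at the fixed state [rho] ([solution_cvg]).  Hence only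
    pointwise convergence of [m1e], [m2e] and [Ue'] on [(0, alpha)] is needed.  The
    last one holds because [Ue'' = Phie' / me] converges to [Phi' / m = U''] locally
    uniformly and [Ue'] agrees with [U'] at [alpha / 2]
    ([regularised_slope_cvg]). *)

(** * Abel summation *)

Lemma abel_summation (R : realType) (n : nat) (s D : nat -> R) :
  D 0%N = 0 ->
  \sum_(i < n.+1) s i * (D i.+1 - D i) =
  s n * D n.+1 - \sum_(i < n) (s i.+1 - s i) * D i.+1.
Proof.
move=> D0; elim: n => [|n IH].
  by rewrite big_ord_recr !big_ord0 /= D0 add0r !subr0.
by rewrite big_ord_recr/= IH [X in _ = _ - X]big_ord_recr/=; ring.
Qed.

(** Both stability estimates are instances of this: [s] is a sign of a difference
    of states or a chemical potential, [D] a difference of fluxes or a flux. *)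
Lemma abel_sum_ge0 (R : realType) (n : nat) (s D : nat -> R) :
  D 0%N = 0 -> D n = 0 ->
  (forall i, (i.+1 < n)%N -> (s i.+1 - s i) * D i.+1 <= 0) ->
  0 <= \sum_(i < n) s i * (D i.+1 - D i).
Proof.
case: n => [|n] D0 Dn sD; first by rewrite big_ord0.
rewrite abel_summation// Dn mulr0 sub0r oppr_ge0.
by apply: sumr_le0 => i _; apply: sD; rewrite ltnS.
Qed.

(** * Implicit monotone schemes *)

Definition entries_in (R : realType) (N : nat) (D : set R) : set 'rV[R]_N :=
  [set rho | forall i, D (rho 0 i)].

(** The implicit scheme reads [backward_step rho1 = rho0]: this operator recovers
    the old state from the new one. *)
Definition backward_step (R : realType) (N : nat) (lam : R) (G : nat -> R -> R -> R)
    (rho : 'rV[R]_N) (i : nat) : R :=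
  cell rho i.+1 + lam * (G i.+1 (cell rho i.+1) (cell rho i.+2) -
                         G i (cell rho i) (cell rho i.+1)).

Record monotone_flux (R : realType) (N : nat) (D : set R)
    (G : nat -> R -> R -> R) : Prop := {
  flux_left : forall a b, G 0%N a b = 0;
  flux_right : forall a b, G N a b = 0;
  flux_mono : forall i a a' b b', D a -> D a' -> D b -> D b' ->
    (0 < i < N)%N -> a <= a' -> b' <= b -> G i a b <= G i a' b' }.

Lemma cell_ord (R : realType) (N : nat) (rho : 'rV[R]_N) (i : 'I_N) :
  cell rho i.+1 = rho 0 i.
Proof. by rewrite /cell /= valK. Qed.

Lemma cell_prop (R : realType) (N : nat) (P : R -> Prop) (rho : 'rV[R]_N) i :
  (i < N)%N -> (forall j, P (rho 0 j)) -> P (cell rho i.+1).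
Proof. by move=> iN; rewrite (cell_ord rho (Ordinal iN)). Qed.

Lemma cell_prop2 (R : realType) (N : nat) (P : R -> R -> Prop)
    (rho eta : 'rV[R]_N) i :
  (i < N)%N -> (forall j, P (rho 0 j) (eta 0 j)) ->
  P (cell rho i.+1) (cell eta i.+1).
Proof.
by move=> iN; rewrite (cell_ord rho (Ordinal iN)) (cell_ord eta (Ordinal iN)).
Qed.

(** Pair the difference of both sides with [s = sg (rho - eta)].  When [s] jumps
    upwards across an interface, [rho] is at most [eta] on its left and at least
    [eta] on its right, so that monotonicity gives [rho] the smaller flux; the
    product of the jump of [s] with the difference of the fluxes is never
    positive. *)
Lemma backward_step_L1_expansive (R : realType) (N : nat) (D : set R) (lam : R)
    (G : nat -> R -> R -> R) (rho eta : 'rV[R]_N) :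
  0 <= lam -> monotone_flux N D G -> entries_in D rho -> entries_in D eta ->
  L1norm (rho - eta) <=
  \sum_(i < N) `|backward_step lam G rho i - backward_step lam G eta i|.
Proof.
move=> lam0 HG Drho Deta.
pose s i := Num.sg (cell rho i.+1 - cell eta i.+1).
pose dG i := G i (cell rho i) (cell rho i.+1) - G i (cell eta i) (cell eta i.+1).
have sdG : 0 <= \sum_(i < N) s i * (dG i.+1 - dG i).
  apply: abel_sum_ge0.
  - by rewrite /dG !(flux_left HG) subrr.
  - by rewrite /dG !(flux_right HG) subrr.
  move=> i iN; have iN' := ltnW iN.
  have Dri := cell_prop iN' Drho; have Dri1 := cell_prop iN Drho.
  have Dei := cell_prop iN' Deta; have Dei1 := cell_prop iN Deta.
  rewrite /s /dG.
  have mono a a' b b' : D a -> D a' -> D b -> D b' -> a <= a' -> b' <= b ->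
      G i.+1 a b <= G i.+1 a' b'.
    by move=> ? ? ? ?; apply: (flux_mono HG) => //; rewrite iN.
  have H1 := mono _ _ _ _ Dri Dei Dri1 Dei1.
  have H2 := mono _ _ _ _ Dei Dri Dei1 Dri1.
  move: H1 H2; move: (cell rho i.+1) (cell eta i.+1) => a a'.
  move: (cell rho i.+2) (cell eta i.+2) => b b'.
  have sgE (x y : R) : Num.sg (x - y) = if x < y then -1 else (y < x)%R%:R.
    case: (ltgtP x y) => [xy|xy|->]; last by rewrite subrr sgr0.
      by rewrite ltr0_sg// subr_lt0.
    by rewrite gtr0_sg// subr_gt0.
  rewrite !sgE.
  case: (ltgtP a a') => [_|_|->]; case: (ltgtP b b') => [_|_|->];
    move=> /= H1 H2; try (have {}H1 := H1 isT isT);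
    try (have {}H2 := H2 isT isT); lra.
apply: (@le_trans _ _ (\sum_(i < N)
    s i * (backward_step lam G rho i - backward_step lam G eta i))).
  have -> : \sum_(i < N)
      s i * (backward_step lam G rho i - backward_step lam G eta i) =
     L1norm (rho - eta) + lam * \sum_(i < N) s i * (dG i.+1 - dG i).
    rewrite /L1norm mulr_sumr -big_split/=; apply: eq_bigr => i _.
    rewrite !mxE -!cell_ord /backward_step normrEsg /s /dG; ring.
  by rewrite lerDl mulr_ge0.
apply: ler_sum => i _; rewrite (le_trans (ler_norm _))// normrM.
rewrite ler_piMl// normr_sg; by case: eqP.
Qed.

Lemma backward_step_mass (R : realType) (N : nat) (D : set R) (lam : R)
    (G : nat -> R -> R -> R) (rho : 'rV[R]_N) :
  monotone_flux N D G ->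
  \sum_(i < N) backward_step lam G rho i = \sum_(i < N) rho 0 i.
Proof.
move=> HG; rewrite /backward_step big_split/= -mulr_sumr.
rewrite -(big_mkord xpredT (fun i => G i.+1 (cell rho i.+1) (cell rho i.+2) -
                         G i (cell rho i) (cell rho i.+1))).
rewrite (telescope_sumr (fun i => G i (cell rho i) (cell rho i.+1)))//.
rewrite (flux_left HG) (flux_right HG) subrr mulr0 addr0.
by apply: eq_bigr => i _; rewrite cell_ord.
Qed.

(** * Existence between barriers *)

(** Tarski's argument: the coordinatewise supremum of the states lying below
    their image is itself below its image, hence so is that image, and the two
    coincide. *)
Lemma monotone_box_fixpoint (R : realType) (N : nat) (a b : R)
    (B : 'rV[R]_N -> 'rV[R]_N) :
  a <= b ->
  (forall rho, entries_in `[a, b] rho -> entries_in `[a, b] (B rho)) ->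
  (forall rho eta, entries_in `[a, b] rho -> entries_in `[a, b] eta ->
     (forall i, rho 0 i <= eta 0 i) -> forall i, B rho 0 i <= B eta 0 i) ->
  exists2 rho, entries_in `[a, b] rho & B rho = rho.
Proof.
move=> ab Bbox Bmono.
pose S : set 'rV[R]_N := [set rho | entries_in `[a, b] rho /\
                            forall i, rho 0 i <= B rho 0 i].
pose Si i : set R := [set rho 0 i | rho in S].
have Sa : S (const_mx a).
  have abox : entries_in `[a, b] (const_mx a : 'rV[R]_N).
    by move=> i; rewrite mxE /= in_itv/= lexx ab.
  split=> // i; rewrite mxE; have := Bbox _ abox i.
  by rewrite /= in_itv/= => /andP[].
have supSi i : has_sup (Si i).
  split; first by exists ((const_mx a : 'rV[R]_N) 0 i); exists (const_mx a).
  exists b => _ [rho [rhobox _] <-]; have := rhobox i.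
  by rewrite /= in_itv/= => /andP[].
pose top : 'rV[R]_N := \row_i sup (Si i).
have le_top rho : S rho -> forall i, rho 0 i <= top 0 i.
  by move=> Srho i; rewrite mxE; apply: ub_le_sup; [case: (supSi i)|exists rho].
have topbox : entries_in `[a, b] top.
  move=> i; rewrite /= in_itv/=; apply/andP; split.
    by have := le_top _ Sa i; rewrite mxE.
  rewrite mxE; apply: ge_sup; first by case: (supSi i).
  by move=> _ [rho [rhobox _] <-]; have := rhobox i; rewrite /= in_itv/= => /andP[].
have top_leB i : top 0 i <= B top 0 i.
  rewrite [top 0 i]mxE; apply: ge_sup; first by case: (supSi i).
  move=> _ [rho Srho <-]; case: (Srho) => rhobox rhoB.
  by rewrite (le_trans (rhoB i))// Bmono//; exact: le_top.
exists top => //; apply/rowP => i; apply/eqP; rewrite eq_le top_leB andbT.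
by apply: le_top; split; [exact: Bbox|exact: Bmono (Bbox _ topbox) top_leB].
Qed.

Lemma cell_const (R : realType) (N : nat) (c : R) i :
  (i < N)%N -> cell (const_mx c : 'rV[R]_N) i.+1 = c.
Proof. by move=> iN; rewrite (cell_ord _ (Ordinal iN)) mxE. Qed.

(** The map to which [monotone_box_fixpoint] applies is a nonlinear Jacobi step:
    with the neighbours of each cell frozen, solve for the value in this cell by
    the intermediate value theorem.  The barriers at [a] and [b] bracket the
    value, since freezing neighbours at higher values lowers the equation. *)
Lemma backward_step_solvable (R : realType) (N : nat) (D : set R) (lam a b : R)
    (G : nat -> R -> R -> R) (rho0 : 'rV[R]_N) :
  0 <= lam -> monotone_flux N D G -> a <= b -> `[a, b] `<=` D ->
  (forall i y, (0 < i < N)%N -> a <= y <= b ->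
     {within `[a, b], continuous (fun x => G i x y)} /\
     {within `[a, b], continuous (G i y)}) ->
  (forall i : 'I_N, backward_step lam G (const_mx a : 'rV[R]_N) i <= rho0 0 i <=
                    backward_step lam G (const_mx b : 'rV[R]_N) i) ->
  exists2 rho : 'rV[R]_N, entries_in `[a, b] rho &
    forall i : 'I_N, backward_step lam G rho i = rho0 0 i.
Proof.
move=> lam0 HG ab abD Gcont barrier.
pose h (rho : 'rV[R]_N) i r :=
  r + lam * (G i.+1 r (cell rho i.+2) - G i (cell rho i) r).
(* Raising the neighbours lowers [h], and raising the own value by [r' - r] raises
   it by at least [r' - r]: the strict part comes from the identity term. *)
have hmono rho eta i r r' : entries_in `[a, b] rho -> entries_in `[a, b] eta ->
    (forall j, rho 0 j <= eta 0 j) -> (i < N)%N -> r <= r' ->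
    a <= r <= b -> a <= r' <= b -> h eta i r + (r' - r) <= h rho i r'.
  move=> rhob etab re iN rr' rb rb'.
  have Dr : D r by apply: abD; rewrite /= in_itv.
  have Dr' : D r' by apply: abD; rewrite /= in_itv.
  have HR : G i.+1 r (cell eta i.+2) <= G i.+1 r' (cell rho i.+2).
    have [iN1|] := ltnP i.+1 N; last first.
      move=> Ni; have -> : i.+1 = N by apply/eqP; rewrite eqn_leq iN Ni.
      by rewrite !(flux_right HG).
    apply: (flux_mono HG) => //.
    - exact: abD (cell_prop iN1 etab).
    - exact: abD (cell_prop iN1 rhob).
    - exact: (cell_prop2 (P := fun x y => x <= y) iN1 re).
  have HL : G i (cell rho i) r' <= G i (cell eta i) r.
    case: i iN {HR} => [|i] iN; first by rewrite !(flux_left HG).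
    have iN' := ltnW iN.
    apply: (flux_mono HG) => //.
    - exact: abD (cell_prop iN' rhob).
    - exact: abD (cell_prop iN' etab).
    - exact: (cell_prop2 (P := fun x y => x <= y) iN' re).
  have := ler_wpM2l lam0 (lerB HR HL); rewrite /h; lra.
have constb c : a <= c <= b -> entries_in `[a, b] (const_mx c : 'rV[R]_N).
  by move=> cb i; rewrite /= mxE in_itv.
have aa : a <= a <= b by rewrite lexx ab.
have bb : a <= b <= b by rewrite lexx ab.
have hconst c i : (i < N)%N ->
    h (const_mx c) i c = backward_step lam G (const_mx c : 'rV[R]_N) i.
  by move=> iN; rewrite /h /backward_step (cell_const c iN).
have hcont (rho : 'rV[R]_N) i : entries_in `[a, b] rho -> (i < N)%N ->
    {within `[a, b], continuous (h rho i)}.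
  move=> rhob iN r.
  have HR : {within `[a, b], continuous (fun r => G i.+1 r (cell rho i.+2))}.
    have [iN1|] := ltnP i.+1 N; last first.
      move=> Ni; have iE : i.+1 = N by apply/eqP; rewrite eqn_leq iN Ni.
      have -> : (fun r => G i.+1 r (cell rho i.+2)) = fun=> 0.
        by apply/funext => x; rewrite iE (flux_right HG).
      by move=> ?; exact: cvg_cst.
    apply: (Gcont _ _ _ _).1 => //.
    by have := cell_prop iN1 rhob; rewrite /= in_itv.
  have HL : {within `[a, b], continuous (G i (cell rho i))}.
    case: i iN {HR} => [|i] iN.
      have -> : G 0%N (cell rho 0) = fun=> 0.
        by apply/funext => x; rewrite (flux_left HG).
      by move=> ?; exact: cvg_cst.
    apply: (Gcont _ _ _ _).2 => //.
    by have := cell_prop (ltnW iN) rhob; rewrite /= in_itv.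
  have idc : {within `[a, b], continuous (fun x : R => x)}.
    by apply: continuous_subspaceT => x; exact: cvg_id.
  apply: cvgD; first exact: idc.
  apply: cvgM; first exact: cvg_cst.
  by apply: cvgB; [exact: HR|exact: HL].
have solve (p : 'rV[R]_N * 'I_N) : exists r, entries_in `[a, b] p.1 ->
    a <= r <= b /\ h p.1 p.2 r = rho0 0 p.2.
  case: p => rho i /=; have [rhob|] := pselect (entries_in `[a, b] rho);
    last by exists 0.
  have iN := ltn_ord i; have /andP[bar1 bar2] := barrier i.
  have ha : h rho i a <= rho0 0 i.
    rewrite (le_trans _ bar1)// -hconst//.
    have := hmono (const_mx a) rho i a a; rewrite subrr addr0; apply => //.
      exact: constb.
    by move=> j; rewrite mxE; have := rhob j; rewrite /= in_itv/= => /andP[].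
  have hb : rho0 0 i <= h rho i b.
    rewrite (le_trans bar2)// -hconst//.
    have := hmono rho (const_mx b) i b b; rewrite subrr addr0; apply => //.
      exact: constb.
    by move=> j; rewrite mxE; have := rhob j; rewrite /= in_itv/= => /andP[].
  have [||r rab hr] := @IVT _ (h rho i) a b (rho0 0 i) ab; first exact: hcont.
    by rewrite ge_min ha/= le_max hb orbT.
  by exists r => _; split=> //; move: rab; rewrite in_itv.
have [B HB] := choice solve.
pose Bmx (rho : 'rV[R]_N) : 'rV[R]_N := \row_i B (rho, i).
have [] := @monotone_box_fixpoint R N a b Bmx ab.
- move=> rho rhob i; rewrite /= mxE in_itv/=.
  by case: (HB (rho, i) rhob).
- move=> rho eta rhob etab re i; rewrite !mxE leNgt; apply/negP => lt.
  have [Br hr] := HB (rho, i) rhob; have [Be he] := HB (eta, i) etab.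
  have := hmono rho eta i _ _ rhob etab re (ltn_ord i) (ltW lt) Be Br.
  by move: hr he => /= -> ->; rewrite gerDl leNgt subr_gt0 lt.
move=> rho rhob Brho; exists rho => // i.
have [_ /= <-] := HB (rho, i) rhob.
have -> : B (rho, i) = rho 0 i by rewrite -[in RHS]Brho mxE.
by rewrite /h /backward_step cell_ord.
Qed.

(** * The upwind flux *)

Definition interface_velocity (R : realType) (N : nat) (u V : R -> R) (i : nat)
    (a b : R) : R :=
  - ((u b + V (midpoint R N i.+1)) - (u a + V (midpoint R N i))) / mesh R N.

Definition interface_flux (R : realType) (N : nat) (m1 m2 u V : R -> R)
    (i : nat) (a b : R) : R :=
  if (0 < i < N)%N then
    m1 a * m2 b * Num.max (interface_velocity N u V i a b) 0 +
    m1 b * m2 a * Num.min (interface_velocity N u V i a b) 0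
  else 0.

Lemma one_stepE (R : realType) (N : nat) (alpha dt : R)
    (m1 m2 U V : R -> R) (rho0 rho1 : 'rV[R]_N) :
  0 < dt ->
  one_step alpha dt m1 m2 U V rho0 rho1 <->
  forall i : 'I_N,
    backward_step (dt / mesh R N) (interface_flux N m1 m2 (derive_on `[0, alpha] U) V)
      rho1 i = rho0 0 i.
Proof.
move=> dt0; have dtE : dt \is a GRing.unit by rewrite unitfE gt_eqF.
have stepE (r1 r0 f g : R) : (r1 - r0) / dt = - (f - g) / mesh R N <->
    r1 + dt / mesh R N * (f - g) = r0.
  split=> [H|<-].
    have := congr1 (fun z => z * dt) H; rewrite mulrVK// => {}H.
    by apply/eqP; rewrite -subr_eq0 addrAC H; apply/eqP; ring.
  by apply: (mulIr dtE); rewrite mulrVK//; ring.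
split=> [H i|H i /andP[]].
  by have /stepE := H i.+1 (ltn_ord i); rewrite (cell_ord rho0).
case: i => // i _ iN; apply/stepE; have := H (Ordinal iN).
by rewrite -(cell_ord rho0).
Qed.

(** Convexity of [U] with [u] in the role of the derivative, in a form that makes
    sense at the end points of an interval as well. *)
Definition subgradient_on (R : realType) (D : set R) (U u : R -> R) : Prop :=
  forall x y, D x -> D y -> U x + u x * (y - x) <= U y.

(** Add the subgradient inequalities at [x] and at [y]. *)
Lemma subgradient_homo (R : realType) (D : set R) (U u : R -> R) (x y : R) :
  subgradient_on D U u -> D x -> D y -> x <= y -> u x <= u y.
Proof.
move=> HU Dx Dy; rewrite le_eqVlt => /predU1P[->//|xy].
rewrite -subr_ge0 -(pmulr_lge0 _ (_ : 0 < y - x)) ?subr_gt0//.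
have := HU x y Dx Dy; have := HU y x Dy Dx; lra.
Qed.

(** The velocity increases in [a] and decreases in [b].  In the first summand so do
    the mobility [m1 a * m2 b] and the positive part; in the second one the
    mobility [m1 b * m2 a] varies the opposite way, but it multiplies a nonpositive
    velocity. *)
Lemma interface_flux_monotone (R : realType) (N : nat) (alpha : R) (D : set R)
    (m m1 m2 U u V : R -> R) :
  mobility_split alpha m m1 m2 -> D `<=` `[0, alpha] -> subgradient_on D U u ->
  monotone_flux N D (interface_flux N m1 m2 u V).
Proof.
move=> Hm Dsub HU; split=> [a b|a b|i a a' b b' Da Da' Db Db' iN aa' bb'].
- by [].
- by rewrite /interface_flux ltnn andbF.
rewrite /interface_flux iN.
have ua := subgradient_homo HU Da Da' aa'.
have ub := subgradient_homo HU Db' Db bb'.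
have vv : interface_velocity N u V i a b <= interface_velocity N u V i a' b'.
  rewrite /interface_velocity ler_wpM2r// ?invr_ge0 ?ler0n//; lra.
have bnd x : D x -> 0 <= x <= alpha by move=> /Dsub; rewrite /= in_itv.
have /andP[a0 aA] := bnd _ Da; have /andP[a0' aA'] := bnd _ Da'.
have /andP[b0 bA] := bnd _ Db; have /andP[b0' bA'] := bnd _ Db'.
have m1a := split_incr Hm a0 aa' aA'; have m2a := split_decr Hm a0 aa' aA'.
have m1b := split_incr Hm b0' bb' bA; have m2b := split_decr Hm b0' bb' bA.
have [p1 p2] := split_ge0 Hm (bnd _ Da).
have [p1' p2'] := split_ge0 Hm (bnd _ Da').
have [q1 q2] := split_ge0 Hm (bnd _ Db).
have [q1' q2'] := split_ge0 Hm (bnd _ Db').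
apply: lerD.
  apply: ler_pM.
  - by rewrite mulr_ge0.
  - by rewrite le_max lexx orbT.
  - exact: ler_pM.
  - by rewrite ge_max !le_max vv lexx /= orbT.
rewrite -lerN2 -!mulrN; apply: ler_pM.
- by rewrite mulr_ge0.
- by rewrite oppr_ge0 ge_min lexx orbT.
- exact: ler_pM.
- by rewrite lerN2 le_min !ge_min vv lexx /= orbT.
Qed.

Lemma interface_flux_velocity_ge0 (R : realType) (N : nat) (alpha : R)
    (m m1 m2 u V : R -> R) (i : nat) (a b : R) :
  mobility_split alpha m m1 m2 -> 0 <= a <= alpha -> 0 <= b <= alpha ->
  0 <= interface_flux N m1 m2 u V i a b * interface_velocity N u V i a b.
Proof.
move=> Hm ha hb; rewrite /interface_flux; case: ifP => _; last by rewrite mul0r.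
have [p1 p2] := split_ge0 Hm ha; have [q1 q2] := split_ge0 Hm hb.
move: (interface_velocity N u V i a b) => v.
rewrite mulrDl -!mulrA; case: (leP v 0) => v0.
  by rewrite mul0r !mulr0 add0r mulr_ge0// mulr_ge0// -expr2 sqr_ge0.
by rewrite mul0r !mulr0 addr0 !mulr_ge0// ltW.
Qed.

(** The subgradient inequality at the new state turns the energy drop into
    [lam * sum_i xi_i (F_{i+1/2} - F_{i-1/2})].  Summed by parts, this pairs each flux
    with the jump of [xi], which is [- dx] times the velocity. *)
Lemma energy_decreases (R : realType) (N : nat) (alpha lam : R) (D : set R)
    (m m1 m2 U V : R -> R) (rho0 rho : 'rV[R]_N) :
  let u := derive_on `[0, alpha] U in
  0 <= lam -> mobility_split alpha m m1 m2 -> D `<=` `[0, alpha] ->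
  subgradient_on D U u ->
  entries_in D rho0 -> entries_in D rho ->
  (forall i : 'I_N,
     backward_step lam (interface_flux N m1 m2 u V) rho i = rho0 0 i) ->
  energy U V rho <= energy U V rho0.
Proof.
move=> u lam0 Hm Dsub HU D0 D1 step; rewrite /energy ler_wpM2l ?invr_ge0//.
pose s i := u (cell rho i.+1) + V (midpoint R N i.+1).
pose F i := interface_flux N m1 m2 u V i (cell rho i) (cell rho i.+1).
have sF : 0 <= \sum_(i < N) s i * (F i.+1 - F i).
  apply: abel_sum_ge0; rewrite /F.
  - by [].
  - by rewrite /interface_flux ltnn andbF.
  move=> i iN; have mesh0 : 0 < mesh R N by rewrite invr_gt0 ltr0n (leq_trans _ iN).
  have bnd j : (j < N)%N -> 0 <= cell rho j.+1 <= alpha.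
    by move=> jN; have := Dsub _ (cell_prop jN D1); rewrite /= in_itv.
  have Fv := @interface_flux_velocity_ge0 _ N _ _ _ _ u V i.+1 _ _ Hm
    (bnd _ (ltnW iN)) (bnd _ iN).
  have -> : s i.+1 - s i = - (mesh R N *
      interface_velocity N u V i.+1 (cell rho i.+1) (cell rho i.+2)).
    by rewrite /interface_velocity mulrC divfK ?gt_eqF// opprK.
  by rewrite mulNr oppr_le0 -mulrA mulr_ge0 ?(ltW mesh0)// mulrC.
rewrite -subr_ge0 -sumrB.
apply: (le_trans (mulr_ge0 lam0 sF)); rewrite mulr_sumr; apply: ler_sum => i _.
have Ei : lam * (F i.+1 - F i) = rho0 0 i - rho 0 i.
  by rewrite -step -cell_ord /backward_step /F; ring.
have := HU _ _ (D1 i) (D0 i); rewrite mulrCA Ei /s cell_ord; lra.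
Qed.

Lemma interface_flux_continuous (R : realType) (N : nat) (m1 m2 u V : R -> R)
    (A : set R) (i : nat) (y : R) :
  {within A, continuous m1} -> {within A, continuous m2} ->
  {within A, continuous u} ->
  {within A, continuous (fun x => interface_flux N m1 m2 u V i x y)} /\
  {within A, continuous (interface_flux N m1 m2 u V i y)}.
Proof.
move=> c1 c2 cu; rewrite /interface_flux; case: (0 < i < N)%N; last first.
  by split=> x; exact: cvg_cst.
have k (c : R) : {within A, continuous (fun _ : R => c)} by move=> x; exact: cvg_cst.
have va : {within A, continuous (fun x => interface_velocity N u V i x y)}.
  move=> x; apply: cvgM; last exact: k.
  by apply: cvgN; apply: cvgB; [exact: k|apply: cvgD; [exact: cu|exact: k]].
have vb : {within A, continuous (interface_velocity N u V i y)}.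
  move=> x; apply: cvgM; last exact: k.
  by apply: cvgN; apply: cvgB; [apply: cvgD; [exact: cu|exact: k]|exact: k].
split=> x; apply: cvgD; apply: cvgM.
- by apply: cvgM; [exact: c1|exact: k].
- exact: (continuous_max (va x) (k 0 x)).
- by apply: cvgM; [exact: k|exact: c2].
- exact: (continuous_min (va x) (k 0 x)).
- by apply: cvgM; [exact: k|exact: c2].
- exact: (continuous_max (vb x) (k 0 x)).
- by apply: cvgM; [exact: c1|exact: k].
- exact: (continuous_min (vb x) (k 0 x)).
Qed.

Lemma lipschitz_within_continuous (R : realType) (A : set R) (f : R -> R) :
  [lipschitz f x | x in A] -> {within A, continuous f}.
Proof.
move=> lf; apply/subspace_continuousP => x Ax.
have [K [K0 HK]] : exists K : R, 0 < K /\ forall y, A y -> `|f x - f y| <= K * `|x - y|.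
  near (pinfty_nbhs R) => K; exists K; split=> [|y Ay].
    by near: K; exact: nbhs_pinfty_gt.
  suff HK : K.-lipschitz_A f by exact: (HK (x, y)).
  by near: K; exact: lf.
apply/cvgrPdist_lt => e e0; have eK : 0 < e / K by rewrite divr_gt0.
rewrite near_withinE; near=> y => Ay.
rewrite (le_lt_trans (HK _ Ay))// mulrC -ltr_pdivlMr//.
Unshelve. all: by end_near. Qed.

(** * Well-posedness and energy dissipation *)

Lemma solution_mapP (R : realType) (N : nat) (B : set 'rV[R]_N)
    (step : 'rV[R]_N -> 'rV[R]_N -> Prop) (rho0 : 'rV[R]_N) :
  (exists rho, B rho /\ step rho0 rho) ->
  B (solution_map B step rho0) /\ step rho0 (solution_map B step rho0).
Proof. exact: (@xgetPex _ 0 [set rho | B rho /\ step rho0 rho]). Qed.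

Lemma L1norm_eq0 (R : realType) (N : nat) (rho : 'rV[R]_N) :
  L1norm rho <= 0 -> rho = 0.
Proof.
move=> rho0; apply/rowP => i; rewrite mxE.
have : L1norm rho == 0 by rewrite eq_le rho0 sumr_ge0.
by rewrite psumr_eq0// => /allP/(_ i); rewrite mem_index_enum normr_eq0 => /(_ isT)/eqP.
Qed.

(** The common core of the open and the closed case, for states with values in an
    order-convex set [D]. *)
Lemma scheme_energy_dissipating (R : realType) (N : nat) (alpha dt : R)
    (D : set R) (m m1 m2 U V : R -> R) :
  let u := derive_on `[0, alpha] U in
  let T := @backward_step R N (dt / mesh R N) (interface_flux N m1 m2 u V) in
  0 < dt -> mobility_split alpha m m1 m2 -> D `<=` `[0, alpha] ->
  subgradient_on D U u ->
  (forall a b, D a -> D b ->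
     `[a, b] `<=` D /\ {within `[a, b], continuous u}) ->
  (forall rho0 : 'rV[R]_N, entries_in D rho0 ->
     exists a b, [/\ a <= b, D a, D b & forall i : 'I_N,
       T (const_mx a) i <= rho0 0 i <= T (const_mx b) i]) ->
  energy_dissipating (entries_in D) (@one_step R N alpha dt m1 m2 U V)
    (@energy R N U V).
Proof.
move=> u T dt0 Hm Dsub HU Dconv barrier.
have lam0 : 0 <= dt / mesh R N by rewrite divr_ge0 ?invr_ge0// ltW.
have HG : monotone_flux N D (interface_flux N m1 m2 u V).
  exact: interface_flux_monotone Hm Dsub HU.
have solvable (rho0 : 'rV[R]_N) : entries_in D rho0 ->
    exists rho, entries_in D rho /\ one_step alpha dt m1 m2 U V rho0 rho.
  move=> /barrier[a [b [ab Da Db abar]]]; have [abD ucont] := Dconv a b Da Db.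
  have [|rho rhob Trho] := backward_step_solvable lam0 HG ab abD _ abar.
    move=> i y _ _; have sub := subset_trans abD Dsub.
    apply: interface_flux_continuous => //; apply: continuous_subspaceW sub _.
      exact: lipschitz_within_continuous (split_lip1 Hm).
    exact: lipschitz_within_continuous (split_lip2 Hm).
  exists rho; split; first by move=> i; exact: abD (rhob i).
  exact/one_stepE.
have solved (rho0 : 'rV[R]_N) (D0 : entries_in D rho0) :=
  solution_mapP (solvable rho0 D0).
have expansive (rho0 eta0 rho eta : 'rV[R]_N) :
    entries_in D rho -> entries_in D eta ->
    one_step alpha dt m1 m2 U V rho0 rho -> one_step alpha dt m1 m2 U V eta0 eta ->
    L1norm (rho - eta) <= L1norm (rho0 - eta0).
  move=> Drho Deta /(one_stepE _ _ _ _ _ _ _ dt0) Hr.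
  move=> /(one_stepE _ _ _ _ _ _ _ dt0) He.
  apply: le_trans (backward_step_L1_expansive lam0 HG Drho Deta) _.
  by apply: ler_sum => i _; rewrite Hr He !mxE.
split.
- move=> rho0 D0; have [rho [Drho Srho]] := solvable _ D0.
  exists rho; split=> // eta [Deta Seta].
  apply/eqP; rewrite -subr_eq0; apply/eqP/L1norm_eq0.
  apply: le_trans (expansive rho0 rho0 _ _ Drho Deta Srho Seta) _.
  by rewrite subrr /L1norm big1// => i _; rewrite mxE normr0.
- move=> rho0 eta0 /solved[Dr Sr] /solved[De Se].
  exact: expansive Dr De Sr Se.
- move=> rho0 /solved[Dr /(one_stepE _ _ _ _ _ _ _ dt0) Sr].
  rewrite -(backward_step_mass (dt / mesh R N) _ HG).
  by apply: eq_bigr => i _; exact: Sr.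
- move=> rho0 D0; have [Dr] := solved _ D0.
  move=> /(one_stepE _ _ _ _ _ _ _ dt0) Sr.
  exact: energy_decreases lam0 Hm Dsub HU D0 Dr Sr.
Qed.

(** * Constant barriers *)

(** On a constant state the two values of [U'] in the velocity cancel and the
    upwind mobilities merge into [m c], so that the flux is [m c] times the slope
    of the potential. *)
Lemma backward_step_const (R : realType) (N : nat) (alpha lam : R)
    (m m1 m2 u V : R -> R) (i : nat) :
  mobility_split alpha m m1 m2 -> (i < N)%N ->
  exists K, forall c, 0 <= c <= alpha ->
    backward_step lam (interface_flux N m1 m2 u V) (const_mx c : 'rV[R]_N) i =
    c + K * m c.
Proof.
move=> Hm iN.
pose w j : R := if (0 < j < N)%N then
  - (V (midpoint R N j.+1) - V (midpoint R N j)) / mesh R N else 0.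
have diag j c : 0 <= c <= alpha -> interface_flux N m1 m2 u V j c c = m c * w j.
  move=> cA; rewrite /interface_flux /w; case: ifP => _; last by rewrite mulr0.
  rewrite -mulrDr -(split_eq Hm cA) addr_max_min /interface_velocity addr0.
  by congr (_ * (- _ / _)); rewrite opprD addrACA subrr add0r.
exists (lam * (w i.+1 - w i)) => c cA; rewrite /backward_step (cell_const c iN).
have -> : interface_flux N m1 m2 u V i.+1 c (cell (const_mx c : 'rV[R]_N) i.+2) =
    m c * w i.+1.
  rewrite -(diag _ _ cA); have [i1N|Ni] := ltnP i.+1 N.
    by rewrite (cell_const c i1N).
  by rewrite /interface_flux [(i.+1 < N)%N]ltnNge Ni.
have -> : interface_flux N m1 m2 u V i (cell (const_mx c : 'rV[R]_N) i) c = m c * w i.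
  rewrite -(diag _ _ cA); case: i iN => // i iN.
  by rewrite (cell_const c (ltnW iN)).
by ring.
Qed.

(** By [backward_step_const] and [m 0 = m alpha = 0], the image of a constant [c]
    tends in each cell to [0] as [c] tends to [0], and to [alpha] as [c] tends to
    [alpha]. *)
Lemma constant_barriers (R : realType) (N : nat) (alpha lam : R)
    (m m1 m2 u V : R -> R) (rho0 : 'rV[R]_N) :
  let T := @backward_step R N lam (interface_flux N m1 m2 u V) in
  0 < alpha -> m 0 = 0 -> m alpha = 0 ->
  mobility_split alpha m m1 m2 -> entries_in `]0, alpha[ rho0 ->
  exists a b, [/\ a <= b, 0 < a < alpha, 0 < b < alpha & forall i : 'I_N,
    T (const_mx a) i <= rho0 0 i <= T (const_mx b) i].
Proof.
move=> T alpha0 m0 mA Hm D0.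
have mcont : {within `[0, alpha], continuous m}.
  apply: (@subspace_eq_continuous _ _ _ (fun x => m1 x * m2 x)).
    by move=> x; rewrite inE/= in_itv/= => xA; exact: esym (split_eq Hm xA).
  move=> x; apply: cvgM.
    exact: (lipschitz_within_continuous (split_lip1 Hm)).
  exact: (lipschitz_within_continuous (split_lip2 Hm)).
have [_ m_right m_left] := (continuous_within_itvP m alpha0).1 mcont.
have D0i i : 0 < rho0 0 i < alpha by have := D0 i; rewrite /= in_itv.
have [a [a0 aA Ta]] : exists a, [/\ 0 < a, a < alpha / 2 &
    forall i : 'I_N, T (const_mx a) i <= rho0 0 i].
  near (0 : R)^'+ => a; exists a; split.
  - by near: a; exact: nbhs_right_gt.
  - by near: a; apply: nbhs_right_lt; rewrite divr_gt0.
  near: a; apply: filter_forall => i.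
  have [K TK] := backward_step_const lam u V Hm (ltn_ord i).
  have lim0 : c + K * m c @[c --> 0^'+] --> (0 : R).
    rewrite -[X in _ --> X](_ : 0 + K * m 0 = 0); last by rewrite m0 mulr0 addr0.
    apply: cvgD; first exact: cvg_at_right_filter cvg_id.
    exact: cvgMr m_right.
  have /andP[ri0 _] := D0i i.
  near=> c; rewrite /T TK; last first.
    by apply/andP; split; near: c; [exact: nbhs_right_ge|exact: nbhs_right_le].
  by apply: ltW; near: c; exact: cvgr_lt lim0 _ ri0.
have [b [b0 bA Tb]] : exists b, [/\ alpha / 2 < b, b < alpha &
    forall i : 'I_N, rho0 0 i <= T (const_mx b) i].
  near alpha^'- => b; exists b; split.
  - by near: b; apply: nbhs_left_gt; lra.
  - by near: b; exact: nbhs_left_lt.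
  near: b; apply: filter_forall => i.
  have [K TK] := backward_step_const lam u V Hm (ltn_ord i).
  have limA : c + K * m c @[c --> alpha^'-] --> alpha.
    rewrite -[X in _ --> X](_ : alpha + K * m alpha = alpha); last first.
      by rewrite mA mulr0 addr0.
    apply: cvgD; first exact: cvg_at_left_filter cvg_id.
    exact: cvgMr m_left.
  have /andP[_ riA] := D0i i.
  near=> c; rewrite /T TK; last first.
    by apply/andP; split; near: c; [exact: nbhs_left_ge|exact: nbhs_left_le].
  by apply: ltW; near: c; exact: cvgr_gt limA _ riA.
by exists a, b; split; [lra|lra|lra|move=> i; rewrite Ta Tb].
Unshelve. all: by end_near. Qed.

(** * Slopes of convex functions *)

Lemma derivable_on_within_continuous (R : realType) (A : set R) (f : R -> R) :
  (forall x, A x -> derivable_on A f x) -> {within A, continuous f}.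
Proof.
move=> df; apply/subspace_continuousP => x Ax.
have /cvg_ex[l fl] := df x Ax.
have lim : f x + (f y - f x) / (y - x) * (y - x) @[y --> within A x^'] --> f x.
  rewrite -[X in _ --> X](_ : f x + l * (x - x) = f x); last first.
    by rewrite subrr mulr0 addr0.
  apply: cvgD; first exact: cvg_cst.
  apply: cvgM; first exact: fl.
  apply: cvgB; last exact: cvg_cst.
  by move=> P xP; do 2 apply: cvg_within.
apply/cvgrPdist_lt => e e0; move/cvgrPdist_lt/(_ e e0): lim.
rewrite /dnbhs !near_withinE; apply: filterS => y /= H Ay.
have [->|yx] := eqVneq y x; first by rewrite subrr normr0.
have := H yx Ay; rewrite mulfVK ?subr_eq0//.
by rewrite [f x + (f y - f x)]addrC subrK.
Qed.

(** By the mean value theorem a difference quotient of [U] is a value of [u] in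
    between.  Derivatives are needed only inside [(a, b)], so that [D] may contain
    the end points. *)
Lemma subgradient_on_primitive (R : realType) (a b : R) (D : set R)
    (U u : R -> R) :
  D `<=` `[a, b] -> {within D, continuous U} ->
  (forall x y, D x -> D y -> `[x, y] `<=` D) ->
  (forall x, a < x < b -> is_derive x 1 U (u x)) ->
  (forall x y, D x -> D y -> x <= y -> u x <= u y) ->
  subgradient_on D U u.
Proof.
move=> Dab Ucont Dconv dU uhomo.
have mvt x y : D x -> D y -> x <= y ->
    exists c, [/\ D c, x <= c <= y & U y - U x = u c * (y - x)].
  move=> Dx Dy xy; have sub := Dconv _ _ Dx Dy.
  have := Dab _ Dx; have := Dab _ Dy; rewrite /= !in_itv/= => /andP[_ yb] /andP[ax _].
  have [||c cxy ->] := @MVT_segment _ U u x y xy.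
  - move=> z; rewrite in_itv/= => /andP[xz zy].
    by apply: dU; rewrite (le_lt_trans ax xz) (lt_le_trans zy yb).
  - exact: continuous_subspaceW sub Ucont.
  by exists c; split=> //; exact: sub.
move=> x y Dx Dy; case: (leP x y) => [xy|/ltW yx].
  have [c [Dc /andP[xc _] E]] := mvt x y Dx Dy xy.
  have := uhomo _ _ Dx Dc xc; rewrite -lerBrDl E => uc.
  by rewrite ler_wpM2r// subr_ge0.
have [c [Dc /andP[_ cx] E]] := mvt y x Dy Dx yx.
have uc := uhomo _ _ Dc Dx cx.
have : u c * (x - y) <= u x * (x - y) by rewrite ler_wpM2r// subr_ge0.
rewrite -E; lra.
Qed.

Definition convex_oo (R : realType) (alpha : R) (U : R -> R) : Prop :=
  forall s, 0 < s < alpha ->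
    [/\ derivable U s 1, derivable (derive1 U) s 1 & 0 <= derive1n 2 U s].

Section convex_oo.
Context (R : realType) (alpha : R) (U : R -> R).
Hypothesis cU : convex_oo alpha U.
Let u := derive_on `[0, alpha] U.

Lemma derive_on_interior s : 0 < s < alpha -> u s = derive1 U s.
Proof.
move=> /andP[s0 sA]; apply: derive_onE.
apply: (@filterS _ _ _ `]0, alpha[); last first.
    by apply: near_in_itvoo; rewrite in_itv/= s0.
by move=> y /=; rewrite !in_itv/= => /andP[/ltW -> /ltW ->].
Qed.

Lemma near_derive_on_interior s : 0 < s < alpha ->
  \forall y \near s, derive1 U y = u y.
Proof.
move=> s0A; apply: (@filterS _ _ _ `]0, alpha[).
  by move=> y /=; rewrite in_itv/= => /derive_on_interior.
by apply: near_in_itvoo; rewrite in_itv.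
Qed.

Lemma derivable_slope s : 0 < s < alpha -> is_derive s 1 u (derive1n 2 U s).
Proof.
move=> s0A; have [_ dU _] := cU s0A.
apply: (near_eq_is_derive (near_derive_on_interior s0A)).
have -> : derive1n 2 U s = 'D_1 (derive1 U) s by rewrite -derive1E.
exact: derivableP.
Qed.

Lemma is_derive_slope s : 0 < s < alpha -> is_derive s 1 U (u s).
Proof.
move=> s0A; have [dU _ _] := cU s0A.
by rewrite derive_on_interior// derive1E; exact: derivableP.
Qed.

Lemma slope_within_continuous_oo : {within `]0, alpha[, continuous u}.
Proof.
apply: derivable_within_continuous => s; rewrite in_itv/= => s0A.
by have [] := derivable_slope s0A.
Qed.

Lemma slope_ge0 s : s \in `]0, alpha[%R -> derivable u s 1 /\ 0 <= derive1 u s.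
Proof.
rewrite in_itv/= => s0A; have [du E] := derivable_slope s0A.
have [_ _ d2] := cU s0A; split; first exact: du.
by rewrite derive1E E; exact: d2.
Qed.

Lemma convex_subgradient_oo : subgradient_on `]0, alpha[ U u.
Proof.
apply: (@subgradient_on_primitive _ 0 alpha).
- exact: subset_itvW.
- apply: derivable_within_continuous => s; rewrite in_itv/= => s0A.
  by have [dU _ _] := cU s0A; exact: dU.
- move=> x y; rewrite /= !in_itv/= => /andP[x0 _] /andP[_ yA] z /=.
  by rewrite !in_itv/= => /andP[xz zy]; rewrite (lt_le_trans x0 xz) (le_lt_trans zy).
- exact: is_derive_slope.
- apply: (@ger0_derive1_le _ _ 0 alpha) => //.
  + by move=> x /slope_ge0[].
  + by move=> x /slope_ge0[].
  + exact: slope_within_continuous_oo.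
Qed.

Lemma convex_subgradient_cc : Cn_cc 1 0 alpha U ->
  subgradient_on `[0, alpha] U u /\ {within `[0, alpha], continuous u}.
Proof.
move=> [dU ucont]; split=> //; apply: (@subgradient_on_primitive _ 0 alpha).
- by [].
- apply: derivable_on_within_continuous => s; rewrite /= in_itv/= => s0A.
  exact: (dU 0%N).
- move=> x y; rewrite /= !in_itv/= => /andP[x0 _] /andP[_ yA] z /=.
  by rewrite !in_itv/= => /andP[xz zy]; rewrite (le_trans x0 xz) (le_trans zy).
- exact: is_derive_slope.
- apply: (@ger0_derive1_le _ _ 0 alpha) => //.
  + by move=> x /slope_ge0[].
  + by move=> x /slope_ge0[].
Qed.

End convex_oo.

(** * Convergence of the regularised slopes *)

(** Near [s] the oriented integral from [s0] differs by a constant from the integral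
    from a point [a] to the left of both [s] and [s0], to which the fundamental
    theorem of calculus applies. *)
Lemma Phi_of_derive (R : realType) (alpha s0 : R) (m U : R -> R) (s : R) :
  let f t := m t * derive1n 2 U t in
  0 < s0 < alpha -> 0 < s < alpha -> L1_oo 0 alpha f ->
  {for s, continuous f} -> derive1 (Phi_of m U s0) s = f s.
Proof.
move=> f /andP[s00 s0A] /andP[s_0 sA] intf fc.
(* Below both base points, but positive, so that [a] stays inside [(0, alpha)]. *)
pose a := Num.min s s0 / 2.
have a0 : 0 < a by rewrite divr_gt0// lt_min s_0.
have [a_s a_s0] : a < s /\ a < s0.
  by rewrite /a; case: (leP s s0) => ?; split; lra.
pose F y := \int[@lebesgue_measure R]_(t in `[a, y]) f t.
have intS (i : interval R) : [set` i] `<=` `]0, alpha[ ->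
    (@lebesgue_measure R).-integrable [set` i] (EFin \o f).
  by move=> iS; apply: integrableS intf => //.
have incl (l : bool) x y : a <= x -> y < alpha ->
    [set` Interval (BSide l x) (BRight y)] `<=` `]0, alpha[.
  move=> ax yA z /=; rewrite !in_itv/= => /andP[xz zy].
  rewrite (le_lt_trans zy yA) andbT (lt_le_trans a0)// (le_trans ax)//.
  by case: l xz => // /ltW.
have split_int x y : a <= x -> x <= y -> y < alpha ->
    \int[@lebesgue_measure R]_(t in `[x, y]) f t = F y - F x.
  move=> ax xy yA; rewrite /F Rintegral_itvB ?bnd_simp//.
    rewrite Rintegral_itv_obnd_cbnd//; apply: intS; exact: incl.
  by apply: intS; exact: incl.
have PhiE y : a < y < alpha -> Phi_of m U s0 y = F y - F s0.
  move=> /andP[ay yA]; rewrite /Phi_of; case: (leP s0 y) => [s0y|ys0].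
    by apply: split_int => //; exact: ltW.
  by rewrite split_int ?opprB// ltW.
have [dF F'] : derivable F s 1 /\ derive1 F s = f s.
  apply: (@continuous_FTC1_closed _ f a s ((s + alpha) / 2)) => //; first lra.
  by apply: intS; apply: incl => //; lra.
rewrite derive1E -(near_eq_derive (f := F - cst (F s0))).
  rewrite deriveB; [|exact: dF|exact: derivable_cst].
  by rewrite derive_cst subr0 -derive1E; exact: F'.
apply: (@filterS _ _ _ `]a, alpha[).
  by move=> y /=; rewrite in_itv/= => yA; rewrite PhiE.
by apply: near_in_itvoo; rewrite in_itv/= a_s.
Qed.

Lemma uniform_cvg_joint (R : realType) (T : Type) (F : set_system T)
    (h : T -> R -> R) (h0 : R -> R) (c d t : R) :
  Filter F -> c < t < d -> {for t, continuous h0} ->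
  {uniform `[c, d], h e @[e --> F] --> h0} ->
  h z.2 z.1 @[z --> filter_prod (nbhs t) F] --> h0 t.
Proof.
move=> FF ctd h0c hu; apply/cvgrPdist_lt => e e0.
have e20 : 0 < e / 2 by rewrite divr_gt0.
have unif : \forall i \near F, forall y, `[c, d] y -> `|h0 y - h i y| < e / 2.
  apply: (hu [set g | forall y, `[c, d] y -> `|h0 y - g y| < e / 2]).
  apply/uniform_nbhs; exists [set p | `|p.1 - p.2| < e / 2]; split=> //.
  by rewrite -entourage_ballE; exists (e / 2).
have tcont : \forall y \near t, `[c, d] y /\ `|h0 t - h0 y| < e / 2.
  near=> y; split.
    near: y; apply: (@filterS _ _ _ `]c, d[); first exact: subset_itvW.
    by apply: near_in_itvoo; rewrite in_itv.
  by near: y; move/cvgrPdist_lt: h0c; apply.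
exists ([set y | `[c, d] y /\ `|h0 t - h0 y| < e / 2],
        [set i | forall y, `[c, d] y -> `|h0 y - h i y| < e / 2]) => //=.
move=> [y i] /= [[cdy hy] /(_ y cdy) hi].
rewrite (splitr e) (le_lt_trans (ler_distD (h0 y) _ _))//.
exact: ltrD.
Unshelve. all: by end_near. Qed.

(** Joint continuity up to the boundary value [0] of the parameter, read as
    convergence along the parameter tending to [0] from the right. *)
Lemma within_cvg_joint (R : realType) (alpha t : R) (h : R -> R -> R) :
  0 < t < alpha ->
  {within `[0, 1] `*` `[0, alpha], continuous (fun p : R * R => h p.1 p.2)} ->
  h z.2 z.1 @[z --> filter_prod (nbhs t) 0^'+] --> h 0 t.
Proof.
move=> tA /subspace_continuousP/(_ (0, t)) hc W hW.
have [] := hc _ W hW.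
  by split; rewrite /= in_itv/= ?lexx ?ler01//; case/andP: tA => /ltW-> /ltW->.
move=> [P Q] /= [P0 Qt] PQ.
exists (Q `&` `]0, alpha[, P `&` `]0, 1]); first split => /=.
- by apply: filterI => //; apply: near_in_itvoo; rewrite in_itv.
- apply: filterI; first by apply: filterS P0 => x.
  near=> e; rewrite /= in_itv/=; apply/andP; split; near: e.
    exact: nbhs_right_gt.
  by apply: nbhs_right_le.
move=> [y e] /= [[Qy yA] [Pe e1]]; apply: (PQ (e, y)) => //=; split.
  by move: e1; rewrite /= !in_itv/= => /andP[/ltW-> ->].
by move: yA; rewrite /= !in_itv/= => /andP[/ltW-> /ltW->].
Unshelve. all: by end_near. Qed.

(** Joint convergence at every point of a compact interval is uniform convergence
    on it, by the covering property of compact sets. *)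
Lemma near_uniform_of_joint (R : realType) (T : Type) (F : set_system T)
    (h : T -> R -> R) (h0 : R -> R) (c d eta : R) :
  Filter F -> 0 < eta -> {in `[c, d]%R, continuous h0} ->
  (forall t, c <= t <= d -> h z.2 z.1 @[z --> filter_prod (nbhs t) F] --> h0 t) ->
  \forall i \near F, forall t, c <= t <= d -> `|h i t - h0 t| < eta.
Proof.
move=> FF eta0 h0c hj.
have := (compact_near_coveringP `[c, d]).1 (@segment_compact _ c d) T F
  (fun i t => `|h i t - h0 t| < eta) FF.
move=> H; apply: filterS (H _) => [i Hi t tcd|t tcd].
  by apply: Hi; rewrite /= in_itv.
have tcd' : c <= t <= d by move: tcd; rewrite /= in_itv.
have lim : h z.2 z.1 - h0 z.1 @[z --> filter_prod (nbhs t) F] --> (0 : R).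
  rewrite -[X in _ --> X](subrr (h0 t)); apply: cvgB; first exact: hj.
  apply: (@cvg_comp _ _ _ fst h0 _ (nbhs t)); first exact: cvg_fst.
  by apply: h0c; rewrite in_itv.
move/cvgrPdist_lt/(_ eta eta0): lim.
by apply: filterS => z /=; rewrite sub0r normrN.
Qed.

(** Locally uniform convergence of the derivatives and equality at one point give
    pointwise convergence, by the mean value theorem for [w i - w0]. *)
Lemma primitive_cvg (R : realType) (T : Type) (F : set_system T)
    (w w' : T -> R -> R) (w0 w0' : R -> R) (a b p s : R) :
  Filter F -> a < p < b -> a < s < b ->
  (\forall i \near F, w i p = w0 p /\
     forall t, a < t < b -> is_derive t 1 (w i) (w' i t)) ->
  (forall t, a < t < b -> is_derive t 1 w0 (w0' t)) ->
  (forall c d eta, a < c -> d < b -> 0 < eta ->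
     \forall i \near F, forall t, c <= t <= d -> `|w' i t - w0' t| < eta) ->
  w i s @[i --> F] --> w0 s.
Proof.
move=> FF /andP[ap pb] /andP[as_ sb] dw dw0 unif.
apply/cvgrPdistC_lt => e e0.
have [K K0 Ks] : exists2 K, 0 < K & `|s - p| < K.
  by exists (`|s - p| + 1); [rewrite ltr_wpDl|rewrite ltrDl].
pose c := Num.min p s; pose d := Num.max p s.
have ac : a < c by rewrite lt_min ap.
have db : d < b by rewrite gt_max pb.
near=> i.
have [wp dwi] : w i p = w0 p /\
    forall t, a < t < b -> is_derive t 1 (w i) (w' i t) by near: i.
have ui : forall t, c <= t <= d -> `|w' i t - w0' t| < e / K.
  by near: i; apply: unif => //; rewrite divr_gt0.
have cd : c <= d by rewrite ge_min !le_max !lexx.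
have incd t : c <= t <= d -> a < t < b.
  by move=> /andP[ct td]; rewrite (lt_le_trans ac ct) (le_lt_trans td db).
have dB t : c <= t <= d -> is_derive t 1 (w i - w0) (w' i t - w0' t).
  by move=> /incd tab; apply: is_deriveB; [exact: dwi|exact: dw0].
have [||z zcd E] := @MVT_segment _ (w i - w0) (fun t => w' i t - w0' t) c d cd.
- move=> t; rewrite in_itv/= => /andP[/ltW ct /ltW td]; apply: dB.
  by rewrite ct td.
- apply: derivable_within_continuous => t; rewrite in_itv/= => /dB.
  by case.
have z_in : c <= z <= d by move: zcd; rewrite in_itv.
have -> : `|w i s - w0 s| = `|(w i - w0) d - (w i - w0) c|.
  have Ep : (w i - w0) p = 0 by rewrite fctE wp subrr.
  rewrite /c /d; case: (leP p s) => _; rewrite Ep ?subr0 ?sub0r ?normrN//.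
rewrite E normrM.
have dc : `|d - c| = `|s - p|.
  by rewrite /c /d; case: (leP p s) => _ //; rewrite distrC.
rewrite dc (le_lt_trans (y := e / K * `|s - p|))//.
  by rewrite ler_wpM2r// ltW// ui.
by rewrite -ltr_pdivlMl ?divr_gt0// invf_div mulfVK ?gt_eqF.
Unshelve. all: by end_near. Qed.

Lemma derivable_continuous_at (R : realType) (f : R -> R) (s : R) :
  derivable f s 1 -> {for s, continuous f}.
Proof. by move=> df; apply/differentiable_continuous/derivable1_diffP. Qed.

Section regularised_entropy.
Context (R : realType) (alpha s0 : R) (m V U kappa : R -> R)
  (Phie me Ue : R -> R -> R).
Hypothesis Hstd : standing_asm alpha s0 m V U.
Hypothesis Hreg : regularisation alpha s0 m U kappa Phie me Ue.

Lemma entropy_convex : convex_oo alpha U.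
Proof.
move=> s s0A; have [dU _] := ent_C3 (std_entropy Hstd) s0A.
split; [exact: (dU 0%N)|exact: (dU 1%N)|].
exact: (ent_convex (std_entropy Hstd) s0A).
Qed.

Lemma Phi_density_continuous s : 0 < s < alpha ->
  {for s, continuous (fun t => m t * derive1n 2 U t)}.
Proof.
move=> s0A; have [dU _] := ent_C3 (std_entropy Hstd) s0A.
have [dm _] := mob_C1 (std_mobility Hstd) s0A.
apply: cvgM; apply: derivable_continuous_at; first exact: (dm 0%N).
exact: (dU 2%N).
Qed.

Lemma Phi_derive s : 0 < s < alpha ->
  derive1 (Phi_of m U s0) s = m s * derive1n 2 U s.
Proof.
move=> s0A; apply: (Phi_of_derive _ s0A).
- exact: (ent_s0 (std_entropy Hstd)).
- exact: (Phi_L1 (std_Phi Hstd)).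
- exact: Phi_density_continuous.
Qed.

(** The regularised [Phi'] is at least [e], as [Phi' = m U''] is nonnegative. *)
Lemma Phie_derive_gt0 e s : 0 < e <= 1 -> 0 < s < alpha ->
  0 < derive1 (Phie e) s.
Proof.
move=> e1 s0A; have /andP[+ _] := Phie_bounds (reg_Phi Hreg) e1 s0A.
apply: lt_le_trans; case/andP: (e1) => e0 _.
rewrite ltr_wpDl// le_min invr_ge0 (ltW (kappa_gt0 (reg_Phi Hreg) e1)) andbT.
rewrite Phi_derive// mulr_ge0//; last exact: (ent_convex (std_entropy Hstd) s0A).
exact: (ltW (mob_gt0 (std_mobility Hstd) s0A)).
Qed.

Lemma regularised_entropy_convex e : 0 < e <= 1 -> convex_oo alpha (Ue e).
Proof.
move=> e1 s s0A; have [dU _] := (Ue_C31 (reg_entropy Hreg) e1).1 s s0A.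
split; [exact: (dU 0%N)|exact: (dU 1%N)|].
rewrite (Ue_second (reg_entropy Hreg) e1 s0A) divr_ge0//.
  exact: (ltW (Phie_derive_gt0 e1 s0A)).
exact: (ltW (me_gt0 (reg_mobility Hreg) e1 s0A)).
Qed.

(** Where [Ue'' = Phie' / me], the numerator converges to [Phi' = m U''] and the
    denominator to [m], which is positive at [t]. *)
Lemma regularised_convexity_joint_cvg t : 0 < t < alpha ->
  derive1n 2 (Ue z.2) z.1 @[z --> filter_prod (nbhs t) (0 : R)^'+] -->
  derive1n 2 U t.
Proof.
move=> tA; case/andP: (tA) => t0 ta.
have mt : 0 < m t by exact: (mob_gt0 (std_mobility Hstd) tA).
have mlim : me z.2 z.1 @[z --> filter_prod (nbhs t) (0 : R)^'+] --> m t.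
  rewrite -(me_zero (reg_mobility Hreg) (s := t)) ?(ltW t0) ?(ltW ta)//.
  exact: (within_cvg_joint tA (me_cont (reg_mobility Hreg))).
have Plim : derive1 (Phie z.2) z.1 @[z --> filter_prod (nbhs t) (0 : R)^'+]
    --> m t * derive1n 2 U t.
  rewrite -Phi_derive//.
  apply: (@uniform_cvg_joint _ _ _ (fun e => derive1 (Phie e)) _
    (t / 2) ((t + alpha) / 2)).
  - lra.
  - rewrite /prop_for /continuous_at Phi_derive//.
    apply: cvg_trans (Phi_density_continuous tA).
    apply: near_eq_cvg; apply: (@filterS _ _ _ `]0, alpha[).
      by move=> y /=; rewrite in_itv/= => /Phi_derive.
    by apply: near_in_itvoo; rewrite in_itv.
  - by apply: (Phie_cvg (reg_Phi Hreg) (k := 1%N)) => //; lra.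
have -> : derive1n 2 U t = m t * derive1n 2 U t * (m t)^-1.
  by rewrite mulrC mulKf// gt_eqF.
apply: cvg_trans (cvgM Plim (cvgV (lt0r_neq0 mt) mlim)); apply: near_eq_cvg.
exists (`]0, alpha[, `]0, 1]) => /=.
  split; first by apply: near_in_itvoo; rewrite in_itv.
  near=> e; rewrite /= in_itv/=; apply/andP; split; near: e.
    exact: nbhs_right_gt.
  by apply: nbhs_right_le.
move=> [y e] /= []; rewrite !in_itv/= => yA e1.
exact: (esym (Ue_second (reg_entropy Hreg) e1 yA)).
Unshelve. all: by end_near. Qed.

Lemma regularised_slope_cvg s : 0 < s < alpha ->
  derive1 (Ue e) s @[e --> 0^'+] --> derive1 U s.
Proof.
move=> s0A; have a0 := alpha_gt0 (std_mobility Hstd).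
have small : \forall e \near (0 : R)^'+, 0 < e <= 1.
  near=> e; apply/andP; split; near: e; first exact: nbhs_right_gt.
  by apply: nbhs_right_le.
have slope W t : convex_oo alpha W -> 0 < t < alpha ->
    is_derive t 1 (derive1 W) (derive1n 2 W t).
  move=> cW tA; have [_ dW _] := cW _ tA.
  have -> : derive1n 2 W t = 'D_1 (derive1 W) t by rewrite -derive1E.
  exact: derivableP.
apply: (@primitive_cvg _ _ _ (fun e => derive1 (Ue e)) (fun e => derive1n 2 (Ue e))
  (derive1 U) (derive1n 2 U) 0 alpha (alpha / 2) s).
- lra.
- exact: s0A.
- apply: filterS small => e e1; split; first exact: (dUe_mid (reg_entropy Hreg) e1).
  by move=> t; apply: slope; exact: regularised_entropy_convex.
- by move=> t; apply: slope; exact: entropy_convex.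
move=> c d eta c0 dA eta0; apply: near_uniform_of_joint => //.
  move=> t; rewrite in_itv/= => /andP[ct td].
  apply: derivable_continuous_at.
  have tA : 0 < t < alpha by rewrite (lt_le_trans c0 ct) (le_lt_trans td dA).
  by have [dU _] := ent_C3 (std_entropy Hstd) tA; exact: (dU 2%N).
move=> t /andP[ct td]; apply: regularised_convexity_joint_cvg.
by rewrite (lt_le_trans c0 ct) (le_lt_trans td dA).
Unshelve. all: by end_near. Qed.

End regularised_entropy.

(** * Stability of the scheme *)

Lemma interface_flux_cvg (R : realType) (N : nat) (T : Type) (F : set_system T)
    (m1 m2 u : T -> R -> R) (n1 n2 v V : R -> R) (i : nat) (a b : R) :
  Filter F ->
  (forall s, s = a \/ s = b -> [/\ m1 e s @[e --> F] --> n1 s,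
     m2 e s @[e --> F] --> n2 s & u e s @[e --> F] --> v s]) ->
  interface_flux N (m1 e) (m2 e) (u e) V i a b @[e --> F] -->
  interface_flux N n1 n2 v V i a b.
Proof.
move=> FF lim; have [m1a m2a ua] := lim a (or_introl erefl).
have [m1b m2b ub] := lim b (or_intror erefl).
rewrite /interface_flux; case: (0 < i < N)%N; last exact: cvg_cst.
have vlim : interface_velocity N (u e) V i a b @[e --> F] -->
    interface_velocity N v V i a b.
  apply: cvgM; last exact: cvg_cst.
  apply: cvgN; apply: cvgB; apply: cvgD => //; exact: cvg_cst.
apply: cvgD; apply: cvgM; do ?by apply: cvgM.
  under eq_fun do rewrite maxr_absE.
  rewrite maxr_absE; apply: cvgM; last exact: cvg_cst.
  apply: cvgD; first by apply: cvgD => //; exact: cvg_cst.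
  by apply: cvg_norm; apply: cvgB => //; exact: cvg_cst.
under eq_fun do rewrite minr_absE.
rewrite minr_absE; apply: cvgM; last exact: cvg_cst.
apply: cvgB; first by apply: cvgD => //; exact: cvg_cst.
by apply: cvg_norm; apply: cvgB => //; exact: cvg_cst.
Qed.

(** The fluxes at the two walls are handled apart: they vanish, and they refer to
    cells outside the grid, whose values need not lie in [D]. *)
Lemma backward_step_cvg (R : realType) (N : nat) (T : Type) (F : set_system T)
    (D : set R) (lam : R) (G : T -> nat -> R -> R -> R) (G0 : nat -> R -> R -> R)
    (rho : 'rV[R]_N) (i : 'I_N) :
  Filter F -> entries_in D rho ->
  (\forall e \near F, monotone_flux N D (G e)) -> monotone_flux N D G0 ->
  (forall j a b, D a -> D b -> G e j a b @[e --> F] --> G0 j a b) ->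
  backward_step lam (G e) rho i @[e --> F] --> backward_step lam G0 rho i.
Proof.
move=> FF Drho HG HG0 lim; rewrite /backward_step.
have faceR : G e i.+1 (cell rho i.+1) (cell rho i.+2) @[e --> F] -->
    G0 i.+1 (cell rho i.+1) (cell rho i.+2).
  have [i1N|] := ltnP i.+1 N.
    by apply: lim; [exact: (cell_prop (ltnW i1N))|exact: (cell_prop i1N)].
  move=> Ni; have iE : i.+1 = N by apply/eqP; rewrite eqn_leq (ltn_ord i) Ni.
  rewrite iE (flux_right HG0); apply: cvg_near_cst.
  by apply: filterS HG => e He; rewrite (flux_right He).
have faceL : G e i (cell rho i) (cell rho i.+1) @[e --> F] -->
    G0 i (cell rho i) (cell rho i.+1).
  case: i {faceR} => [[|i] /= iN].
    rewrite (flux_left HG0); apply: cvg_near_cst.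
    by apply: filterS HG => e He; rewrite (flux_left He).
  by apply: lim; [exact: (cell_prop (ltnW iN))|exact: (cell_prop iN)].
apply: cvgD; first exact: cvg_cst.
by apply: cvgM; [exact: cvg_cst|exact: cvgB].
Qed.

Lemma le_L1norm (R : realType) (N : nat) (rho : 'rV[R]_N) i :
  `|rho 0 i| <= L1norm rho.
Proof. by rewrite /L1norm (bigD1 i)//= lerDl sumr_ge0. Qed.

(** Stability turns consistency into convergence: since each operator expands
    the [L^1] distance, [rho e] is no further from [rho_lim] than the image of
    [rho_lim] under the [e]-th operator is from its limit. *)
Lemma solution_cvg (R : realType) (N : nat) (T : Type) (F : set_system T)
    (D : set R) (lam : R) (G : T -> nat -> R -> R -> R) (G0 : nat -> R -> R -> R)
    (rho : T -> 'rV[R]_N) (rho_lim : 'rV[R]_N) :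
  Filter F -> 0 <= lam -> entries_in D rho_lim ->
  (\forall e \near F, [/\ monotone_flux N D (G e), entries_in D (rho e) &
     forall i : 'I_N,
       backward_step lam (G e) (rho e) i = backward_step lam G0 rho_lim i]) ->
  monotone_flux N D G0 ->
  (forall j a b, D a -> D b -> G e j a b @[e --> F] --> G0 j a b) ->
  rho e @[e --> F] --> rho_lim.
Proof.
move=> FF lam0 Dlim Hrho HG0 lim.
(* The consistency error of the [e]-th scheme at the limit state. *)
have defect : \sum_(i < N)
    `|backward_step lam G0 rho_lim i - backward_step lam (G e) rho_lim i|
    @[e --> F] --> (0 : R).
  rewrite -[X in _ --> X](_ : \sum_(i < N)
    `|backward_step lam G0 rho_lim i - backward_step lam G0 rho_lim i| = 0);
    last first.
    by rewrite big1// => i _; rewrite subrr normr0.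
  apply: cvg_big => [|i _]; first exact: add_continuous.
  apply: cvg_norm; apply: cvgB; first exact: cvg_cst.
  apply: (backward_step_cvg (D := D)) => //.
  by apply: filterS Hrho => e [].
apply/cvg_ballP => eps eps0.
move/cvgrPdist_lt/(_ eps eps0): defect; apply: filterS2 Hrho => e [He De Ee].
rewrite sub0r normrN => small; split=> // i j; rewrite /ball/= ord1.
have -> : rho_lim 0 j - rho e 0 j = (rho_lim - rho e) 0 j by rewrite !mxE.
rewrite (le_lt_trans (le_L1norm _ _))//.
apply: le_lt_trans _ small; rewrite ger0_norm ?sumr_ge0//.
apply: le_trans (backward_step_L1_expansive lam0 He Dlim De) _.
by apply: ler_sum => k _; rewrite Ee distrC.
Qed.

(** * The schemes *)

Lemma A_openE (R : realType) (N : nat) (alpha : R) :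
  @A_open R N alpha = entries_in `]0, alpha[.
Proof.
by apply/seteqP; split=> rho H i; have := H i; rewrite /= in_itv.
Qed.

Lemma A_closedE (R : realType) (N : nat) (alpha : R) :
  @A_closed R N alpha = entries_in `[0, alpha].
Proof.
by apply/seteqP; split=> rho H i; have := H i; rewrite /= in_itv.
Qed.

Lemma open_scheme_dissipating (R : realType) (N : nat) (alpha dt : R)
    (m m1 m2 U V : R -> R) :
  0 < alpha -> 0 < dt -> m 0 = 0 -> m alpha = 0 ->
  mobility_split alpha m m1 m2 -> convex_oo alpha U ->
  energy_dissipating (@A_open R N alpha) (one_step alpha dt m1 m2 U V)
    (energy U V).
Proof.
move=> a0 dt0 m0 mA Hm cU; rewrite A_openE.
apply: (@scheme_energy_dissipating R N alpha dt _ m m1 m2 U V dt0 Hm).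
- exact: subset_itvW.
- exact: (convex_subgradient_oo cU).
- move=> a b; rewrite /= !in_itv/= => /andP[a_gt0 _] /andP[_ bA].
  have sub : `[a, b] `<=` `]0, alpha[.
    move=> z /=; rewrite !in_itv/= => /andP[az zb].
    by rewrite (lt_le_trans a_gt0 az) (le_lt_trans zb bA).
  by split=> //; exact: continuous_subspaceW sub (slope_within_continuous_oo cU).
- move=> rho0 D0.
  have [a [b [ab aA bA bar]]] := constant_barriers (dt / mesh R N)
    (derive_on `[0, alpha] U) V a0 m0 mA Hm D0.
  by exists a, b; split=> //; rewrite /= in_itv.
Qed.

Lemma closed_scheme_dissipating (R : realType) (N : nat) (alpha dt : R)
    (m m1 m2 U V : R -> R) :
  0 < alpha -> 0 < dt -> m 0 = 0 -> m alpha = 0 ->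
  mobility_split alpha m m1 m2 -> convex_oo alpha U -> Cn_cc 1 0 alpha U ->
  energy_dissipating (@A_closed R N alpha) (one_step alpha dt m1 m2 U V)
    (energy U V).
Proof.
move=> a0 dt0 m0 mA Hm cU C1U; rewrite A_closedE.
have [HU ucont] := convex_subgradient_cc cU C1U.
apply: (@scheme_energy_dissipating R N alpha dt _ m m1 m2 U V dt0 Hm) => //.
- move=> a b; rewrite /= !in_itv/= => /andP[a_ge0 _] /andP[_ bA].
  have sub : `[a, b] `<=` `[0, alpha].
    move=> z /=; rewrite !in_itv/= => /andP[az zb].
    by rewrite (le_trans a_ge0 az) (le_trans zb bA).
  by split=> //; exact: continuous_subspaceW sub ucont.
- move=> rho0 D0; exists 0, alpha; split; first exact: ltW.
  + by rewrite /= in_itv/= lexx ltW.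
  + by rewrite /= in_itv/= lexx ltW.
  move=> i; have [K TK] := backward_step_const (dt / mesh R N)
    (derive_on `[0, alpha] U) V Hm (ltn_ord i).
  rewrite !TK ?lexx ?(ltW a0)// m0 mA mulr0 !addr0.
  by have := D0 i; rewrite /= in_itv.
Qed.

Theorem theorem2p13 (R : realType) (alpha s0 : R) (m V U : R -> R)
    (kappa : R -> R) (Phie me Ue : R -> R -> R)
    (m1 m2 : R -> R) (m1e m2e : R -> R -> R)
    (Hstd : standing_asm alpha s0 m V U)
    (Hreg : regularisation alpha s0 m U kappa Phie me Ue)
    (Hsplit : mobility_split alpha m m1 m2)
    (Hsplite : forall e : R, 0 < e <= 1 ->
       mobility_split alpha (me e) (m1e e) (m2e e))
    (N : nat) (dt : R) (HN : (0 < N)%N) (Hdt : 0 < dt) :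
  let step := @one_step R N alpha dt m1 m2 U V in
  let stepe e := @one_step R N alpha dt (m1e e) (m2e e) (Ue e) V in
  [/\ energy_dissipating (@A_open R N alpha) step (@energy R N U V),
      forall e : R, 0 < e <= 1 ->
        energy_dissipating (@A_open R N alpha) (stepe e) (@energy R N (Ue e) V),
      (forall s : R, 0 <= s <= alpha ->
         m1e e s @[e --> 0^'+] --> m1 s /\ m2e e s @[e --> 0^'+] --> m2 s) ->
      forall rho0 : 'rV[R]_N, A_open alpha rho0 ->
        solution_map (A_open alpha) (stepe e) rho0 @[e --> 0^'+] -->
        solution_map (A_open alpha) step rho0 &
      Cn_cc 1 0 alpha U ->
        energy_dissipating (@A_closed R N alpha) step (@energy R N U V)].
Proof.
move=> step stepe.
have a0 := alpha_gt0 (std_mobility Hstd).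
have m0 := mob_0 (std_mobility Hstd); have mA := mob_alpha (std_mobility Hstd).
have cU := entropy_convex Hstd.
have cUe e (e1 : 0 < e <= 1) := regularised_entropy_convex Hstd Hreg e1.
have fed : energy_dissipating (@A_open R N alpha) step (@energy R N U V).
  exact: open_scheme_dissipating Hsplit cU.
have fede e : 0 < e <= 1 ->
    energy_dissipating (@A_open R N alpha) (stepe e) (@energy R N (Ue e) V).
  move=> e1; apply: open_scheme_dissipating (Hsplite e e1) (cUe e e1) => //.
  - exact: (me_0 (reg_mobility Hreg) e1).
  - exact: (me_alpha (reg_mobility Hreg) e1).
split=> //; last exact: closed_scheme_dissipating Hsplit cU.
move=> split_cvg rho0 D0.
have solved step' E' : energy_dissipating (@A_open R N alpha) step' E' ->
    A_open alpha (solution_map (A_open alpha) step' rho0) /\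
    step' rho0 (solution_map (A_open alpha) step' rho0).
  by move=> /fed_solvable/(_ rho0 D0)[rho [Hrho _]]; apply: solution_mapP; exists rho.
have [Dlim] := solved _ _ fed.
rewrite /step (one_stepE _ _ _ _ _ _ _ Hdt) => Slim.
have Dsub : `]0, alpha[ `<=` `[0, alpha] by exact: subset_itvW.
pose G e := interface_flux N (m1e e) (m2e e) (derive_on `[0, alpha] (Ue e)) V.
pose G0 := interface_flux N m1 m2 (derive_on `[0, alpha] U) V.
apply: (@solution_cvg _ _ _ _ `]0, alpha[ (dt / mesh R N) G G0).
- by rewrite divr_ge0 ?invr_ge0// ltW.
- by rewrite -A_openE.
- near=> e; have e1 : 0 < e <= 1.
    by apply/andP; split; near: e; [exact: nbhs_right_gt|apply: nbhs_right_le].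
  have [De] := solved _ _ (fede e e1).
  rewrite /stepe (one_stepE _ _ _ _ _ _ _ Hdt) => Se; split.
  + exact: (interface_flux_monotone _ _ (Hsplite e e1) Dsub
      (convex_subgradient_oo (cUe e e1))).
  + by rewrite -A_openE.
  + by move=> i; rewrite Se Slim.
- exact: (interface_flux_monotone _ _ Hsplit Dsub (convex_subgradient_oo cU)).
move=> j a b; rewrite /= !in_itv/= => aA bA; apply: interface_flux_cvg => s sab.
have sA : 0 < s < alpha by case: sab => ->.
have [l1 l2] : m1e e s @[e --> 0^'+] --> m1 s /\ m2e e s @[e --> 0^'+] --> m2 s.
  by apply: split_cvg; case/andP: sA => /ltW-> /ltW->.
split=> //; rewrite derive_on_interior//.
under eq_fun do rewrite derive_on_interior//.
exact: (regularised_slope_cvg Hstd Hreg sA).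
Unshelve. all: by end_near. Qed.
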